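(* Let $\Lambda\subset\mathbb{R}^2$ be a set of equidistant parallel lines or a lattice. Then $\mathfrak{C}(\Lambda)$ is dense in $L^2(\mathbb{R})$.
   Context: The Gabor transform of $f\in L^2(\mathbb{R})$ is $$\mathcal{G}f(x,\omega)=2^{1/4}\int_{\mathbb{R}}f(t)\,\mathrm{e}^{-\pi(t-x)^2}\mathrm{e}^{-2\pi\mathrm{i}t\omega}\,\mathrm{d}t,\qquad (x,\omega)\in\mathbb{R}^2.$$ Here $L^2(\mathbb{R})$ consists of complex-valued functions. Write $f\sim g$ if there is $\alpha\in\mathbb{R}$ with $f=\mathrm{e}^{\mathrm{i}\alpha}g$. For $\Lambda\subset\mathbb{R}^2$, the class of counterexamples for sampled Gabor phase retrieval on $\Lambda$ is $$\mathfrak{C}(\Lambda)=\{f\in L^2(\mathbb{R}):\exists\,g\in L^2(\mathbb{R})\text{ such that } f\not\sim g\text{ and }|\mathcal{G}f|=|\mathcal{G}g|\text{ on }\Lambda\}.$$ A lattice is a set of the form $L\mathbb{Z}^k$, where $k\in\{1,2\}$ and $L\in\mathbb{R}^{2\times k}$ has linearly independent columns. A set of equidistant parallel lines is a set of the form $\operatorname{R}_\theta(\mathbb{R}\times a\mathbb{Z})+\lambda_0$ with $a>0$, $\theta\in\mathbb{R}$, $\lambda_0\in\mathbb{R}^2$, where $\operatorname{R}_\theta$ denotes rotation of $\mathbb{R}^2$ by the angle $\theta$. *)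

(* Defs.v *)
From HB Require Import structures.
From mathcomp Require Import all_boot all_order all_algebra.
From mathcomp Require Import complex.
From mathcomp Require Import all_classical all_reals all_analysis.

Set Implicit Arguments.
Unset Strict Implicit.
Unset Printing Implicit Defensive.
Import Order.TTheory GRing.Theory Num.Theory.
Local Open Scope classical_set_scope.
Local Open Scope ring_scope.
Local Open Scope complex_scope.

(* MathComp-Analysis has no measurable structure or Lebesgue integral on R[i]:
   both are taken componentwise. *)
Definition cmeasurable (R : realType) (f : R -> R[i]) : Prop :=
  measurable_fun [set: R] (fun t => complex.Re (f t)) /\
  measurable_fun [set: R] (fun t => complex.Im (f t)).

(* Each component of Rintegral defaults to a junk value when it does not exist;
   this never occurs in the Gabor transform of an L^2 function. *)
Definition cintegral (R : realType) (f : R -> R[i]) : R[i] :=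
  Rintegral (@lebesgue_measure R) [set: R] (fun t => complex.Re (f t)) +i*
  Rintegral (@lebesgue_measure R) [set: R] (fun t => complex.Im (f t)).

Definition cnorm (R : realType) (z : R[i]) : R := complex.Re `|z|.

Definition L2norm (R : realType) (f : R -> R[i]) : \bar R :=
  Lnorm (@lebesgue_measure R) 2%:E (fun t => (cnorm (f t))%:E).

(* Elements of L^2(R) are represented by functions rather than by classes
   modulo almost everywhere equality. *)
Definition L2 (R : realType) : set (R -> R[i]) :=
  [set f | cmeasurable f /\ (L2norm f < +oo)%E].
Arguments L2 R : clear implicits.

Definition dense_in_L2 (R : realType) (S : set (R -> R[i])) : Prop :=
  S `<=` L2 R /\
  forall f, L2 R f -> forall e : R, 0 < e ->
    exists2 h, S h & (L2norm (fun t => f t - h t)%R < e%:E)%E.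

Definition cis (R : realType) (a : R) : R[i] := cos a +i* sin a.

Definition gabor (R : realType) (f : R -> R[i]) (x w : R) : R[i] :=
  (2 `^ 4^-1)%:C *
  cintegral (fun t => f t * (expR (- (pi * (t - x) ^+ 2)))%:C
                      * cis (- (2 * pi * t * w))).

(* Equality in L^2 is almost everywhere equality. *)
Definition phase_equiv (R : realType) (f g : R -> R[i]) : Prop :=
  exists a : R, {ae @lebesgue_measure R, forall t, f t = cis a * g t}.

(* A point (x, w) of the plane is the column vector z with
   z 0 0 = x and z 1 0 = w. *)
Definition counterexamples (R : realType) (Lambda : set 'cV[R]_2) :
    set (R -> R[i]) :=
  [set f | L2 R f /\ exists g, [/\ L2 R g, ~ phase_equiv f g &
     forall z : 'cV[R]_2, Lambda z ->
       `|gabor f (z 0 0) (z 1 0)| = `|gabor g (z 0 0) (z 1 0)| ]].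

Definition is_lattice (R : realType) (Lambda : set 'cV[R]_2) : Prop :=
  exists k : nat, (k = 1%N \/ k = 2%N) /\
  exists L : 'M[R]_(2, k), row_free L^T /\
    Lambda = range (fun n : 'cV[int]_k => L *m map_mx (fun m => m%:~R) n).

Definition rotation (R : realType) (th : R) : 'M[R]_2 :=
  \matrix_(i, j) (if i == j then cos th
                  else if i == 0 then - sin th else sin th).

Definition is_equidistant_parallel_lines (R : realType)
    (Lambda : set 'cV[R]_2) : Prop :=
  exists (a th : R) (lambda0 : 'cV[R]_2), 0 < a /\
    Lambda = [set rotation th *m v + lambda0 | v in
               [set v : 'cV[R]_2 | exists n : int, v 1 0 = a * n%:~R]].

(* Main.v *)
(* Up to a factor depending only on (x, w), the Gabor transform of f is the
   Laplace transform of f(t) exp(- pi t^2) at zeta = x - i w.  There is an affine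
   form p x + q w + r that is integral on Lambda, hence some s with
   E = exp(2 pi s zeta + i pi r) real on Lambda.  If f and g are such that the
   transform of g is E times that of f, then, for every real d > 0, f + i d g and
   f - i d g have transforms (1 + i d E) Gf and (1 - i d E) Gf, of equal modulus
   on Lambda; they are not equivalent, because E is not constant and a small
   Gaussian added to f makes Gf nonzero at two points where E differs.  It remains
   to see that the f admitting such a partner g are dense.  They form a subspace
   containing all exp(- pi t^2 + 2 pi i l t), as the transform of
   exp(- pi t^2 + 2 pi mu t) is explicit for complex mu and multiplying it by
   exp(2 pi s zeta) replaces mu by mu + 2 s.  The span of these functions is dense:
   polynomials in sin((t - x) / n) converge boundedly to the indicator of the ray
   ]x, +oo[, a Dynkin class argument gives the indicators of all Borel sets (times
   the Gaussian), and simple functions give the rest. *)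
Require Import Defs.
From HB Require Import structures.
From mathcomp Require Import all_boot all_order all_algebra.
From mathcomp Require Import complex.
From mathcomp Require Import all_classical all_reals all_analysis.
From mathcomp Require Import measurable_realfun ring lra.

Set Implicit Arguments.
Unset Strict Implicit.
Unset Printing Implicit Defensive.
Import Order.TTheory GRing.Theory Num.Theory.
Import numFieldNormedType.Exports.
Local Open Scope classical_set_scope.
Local Open Scope ring_scope.
Local Open Scope complex_scope.


(** * Complex shifts of the Gaussian integral *)

(** Completing the square: the integrand is a constant multiple of the normal density of mean
    [b / (2 * c)] and variance [1 / (2 * c)]. *)
Lemma integrable_gaussian (R : realType) (c b : R) : 0 < c ->
  (@lebesgue_measure R).-integrable [set: R]
    (EFin \o (fun t => expR (- (c * t ^+ 2) + b * t))).
Proof.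
move=> c0.
pose s := Num.sqrt (2 * c)^-1; pose m := b / (2 * c).
have s2 : s ^+ 2 = (2 * c)^-1 by rewrite sqr_sqrtr// invr_ge0 mulr_ge0// ltW.
have s0 : s != 0.
  by rewrite gt_eqF// sqrtr_gt0 invr_gt0 mulr_gt0.
pose K := expR (b ^+ 2 / (4 * c)) / normal_peak s.
have := integrableZl measurableT K (integrable_normal_pdf m s).
apply: eq_integrable => // t _ /=.
rewrite normal_pdfE// -EFinM /K; congr (_%:E).
rewrite -!mulrA mulKf ?gt_eqF ?normal_peak_gt0//.
rewrite /normal_fun -expRD s2; congr expR; rewrite /m.
by field; rewrite gt_eqF.
Qed.

(** With the next lemma, these are the real and imaginary parts of the rule (exp (A + i B))' = (a +
    i b) exp (A + i B). *)
Lemma is_derive_exp_cos (R : realType) (A B : R -> R) (x a b : R) :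
  is_derive x 1 A a -> is_derive x 1 B b ->
  is_derive x 1 (fun t => expR (A t) * cos (B t))
    (expR (A x) * (a * cos (B x) - b * sin (B x))).
Proof.
move=> dA dB.
have d1 := is_derive1_comp (is_derive_expR (A x)) dA.
have d2 := is_derive1_comp (is_derive_cos (B x)) dB.
have := is_deriveM d1 d2.
move/is_derive_eq; apply => /=.
rewrite /= -![_ *: _]/(_ * _); ring.
Qed.

Lemma is_derive_exp_sin (R : realType) (A B : R -> R) (x a b : R) :
  is_derive x 1 A a -> is_derive x 1 B b ->
  is_derive x 1 (fun t => expR (A t) * sin (B t))
    (expR (A x) * (a * sin (B x) + b * cos (B x))).
Proof.
move=> dA dB.
have d1 := is_derive1_comp (is_derive_expR (A x)) dA.
have d2 := is_derive1_comp (is_derive_sin (B x)) dB.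
have := is_deriveM d1 d2.
move/is_derive_eq; apply => /=.
rewrite /= -![_ *: _]/(_ * _); ring.
Qed.

(** The fundamental theorem of calculus on growing symmetric intervals, then dominated convergence
    with [|v|] as dominating function. *)
Lemma integral_derivative_eq0 (R : realType) (u v : R -> R) :
  (forall x : R, is_derive x (1 : R) u (v x)) -> continuous v ->
  (@lebesgue_measure R).-integrable [set: R] (EFin \o v) ->
  (fun n => u n%:R) @ \oo --> (0 : R) -> (fun n => u (- n%:R)) @ \oo --> (0 : R) ->
  \int[@lebesgue_measure R]_x v x = 0.
Proof.
move=> uv cv iv up un.
set mu := @lebesgue_measure R.
have cu : continuous u.
  move=> x; apply: differentiable_continuous; apply/derivable1_diffP.
  by have [] := uv x.
(* The successor keeps the interval nondegenerate at n = 0. *)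
pose w (n : nat) := (EFin \o v) \_ `[- n.+1%:R, n.+1%:R].
have Iw n : (\int[mu]_x w n x = (u n.+1%:R - u (- n.+1%:R))%:E)%E.
  rewrite -integral_mkcond; rewrite EFinB.
  apply: (@continuous_FTC2 R v u).
  - by rewrite -subr_gt0 opprK addr_gt0.
  - by apply: continuous_subspaceT.
  - split.
    + by move=> x _; have [] := uv x.
    + by apply: cvg_at_right_filter; exact: cu.
    + by apply: cvg_at_left_filter; exact: cu.
  - move=> x _; rewrite derive1E; exact: derive_val.
have vm : measurable_fun [set: R] (EFin \o v) by apply: (measurable_int mu).
have wm n : measurable_fun [set: R] (w n).
  by apply/(measurable_restrictT _ (measurable_itv _)); exact: measurable_funTS.
have wv : {ae mu, forall x, [set: R] x -> w ^~ x @ \oo --> (EFin \o v) x}.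
  apply: aeW => x _; apply: cvg_near_cst; near=> n; rewrite /w patchE.
  rewrite mem_set//= in_itv/= -ler_norml.
  rewrite (@le_trans _ _ n%:R) ?ler_nat//.
  by near: n; apply: nbhs_infty_ger.
have wle : {ae mu, forall x n, [set: R] x -> (`|w n x| <= `|(EFin \o v) x|)%E}.
  apply: aeW => x n _; rewrite /w patchE; case: ifPn => // _.
  by rewrite abse0.
have [_ _ /=] := @dominated_convergence _ _ _ mu setT measurableT w (EFin \o v)
   (abse \o (EFin \o v)) wm vm wv (integrable_abse iv) wle.
under eq_fun do rewrite Iw.
move=> cI; rewrite /Rintegral; apply/esym.
suff -> : (\int[mu]_x (v x)%:E = 0%:E)%E by [].
apply: (cvg_unique _ cI) => //.
apply: cvg_EFin; first by apply: nearW.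
rewrite -[X in _ --> X](subr0 0).
apply: cvgB.
  by move: up; rewrite -cvg_shiftS.
by move: un; rewrite -cvg_shiftS.
Unshelve. all: by end_near.
Qed.

Section gaussian_shift.
Context {R : realType}.
Let mu := @lebesgue_measure R.
Variables (c p q : R).
Hypothesis c0 : 0 < c.

(* The real and imaginary parts of exp (- c (t - tau (p + i q))^2). *)
Definition gshift_re (tau t : R) : R :=
  expR (- c * ((t - tau * p) ^+ 2 - (tau * q) ^+ 2)) *
  cos (2 * c * (t - tau * p) * (tau * q)).
Definition gshift_im (tau t : R) : R :=
  expR (- c * ((t - tau * p) ^+ 2 - (tau * q) ^+ 2)) *
  sin (2 * c * (t - tau * p) * (tau * q)).

(** [T_re] and [T_im] are the real and imaginary parts of the derivative in t, which is - 2 c (t -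
    tau (p + i q)) exp (- c (t - tau (p + i q))^2). *)
Let T_re (tau t : R) : R :=
  expR (- c * ((t - tau * p) ^+ 2 - (tau * q) ^+ 2)) *
  ((- (2 * c) * (t - tau * p)) * cos (2 * c * (t - tau * p) * (tau * q)) -
   (2 * c * (tau * q)) * sin (2 * c * (t - tau * p) * (tau * q))).
Let T_im (tau t : R) : R :=
  expR (- c * ((t - tau * p) ^+ 2 - (tau * q) ^+ 2)) *
  ((- (2 * c) * (t - tau * p)) * sin (2 * c * (t - tau * p) * (tau * q)) +
   (2 * c * (tau * q)) * cos (2 * c * (t - tau * p) * (tau * q))).

Let is_derive_t_exponent (tau t : R) :
  is_derive t 1 (fun t => - c * ((t - tau * p) ^+ 2 - (tau * q) ^+ 2))
    (- (2 * c) * (t - tau * p)).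
Proof. by apply: is_derive_eq; rewrite -![_ *: _]/(_ * _); ring. Qed.

Let is_derive_t_phase (tau t : R) :
  is_derive t 1 (fun t => 2 * c * (t - tau * p) * (tau * q))
    (2 * c * (tau * q)).
Proof. by apply: is_derive_eq; rewrite -![_ *: _]/(_ * _); ring. Qed.

Let is_derive_tau_exponent (tau t : R) :
  is_derive tau 1 (fun tau => - c * ((t - tau * p) ^+ 2 - (tau * q) ^+ 2))
    (2 * c * (t - tau * p) * p + 2 * c * (tau * q) * q).
Proof. by apply: is_derive_eq; rewrite -![_ *: _]/(_ * _); ring. Qed.

Let is_derive_tau_phase (tau t : R) :
  is_derive tau 1 (fun tau => 2 * c * (t - tau * p) * (tau * q))
    (2 * c * (t - tau * p) * q - 2 * c * p * (tau * q)).
Proof. by apply: is_derive_eq; rewrite -![_ *: _]/(_ * _); ring. Qed.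

Let is_derive_t_re tau t : is_derive t (1:R) (gshift_re tau) (T_re tau t).
Proof.
by have := is_derive_exp_cos (is_derive_t_exponent tau t) (is_derive_t_phase tau t).
Qed.

Let is_derive_t_im tau t : is_derive t (1:R) (gshift_im tau) (T_im tau t).
Proof.
by have := is_derive_exp_sin (is_derive_t_exponent tau t) (is_derive_t_phase tau t).
Qed.

(** The real part of - (p + i q) (T_re + i T_im); the next lemma is the imaginary part. *)
Let is_derive_tau_re tau t :
  is_derive tau (1:R) (gshift_re^~ t) (- p * T_re tau t + q * T_im tau t).
Proof.
have := is_derive_exp_cos (is_derive_tau_exponent tau t) (is_derive_tau_phase tau t).
by move/is_derive_eq; apply; rewrite /T_re /T_im; ring.
Qed.

Let is_derive_tau_im tau t :
  is_derive tau (1:R) (gshift_im^~ t) (- p * T_im tau t - q * T_re tau t).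
Proof.
have := is_derive_exp_sin (is_derive_tau_exponent tau t) (is_derive_tau_phase tau t).
by move/is_derive_eq; apply; rewrite /T_re /T_im; ring.
Qed.

(** Bounds uniform in |tau| <= N: [M] for the shifts, [D] for the Gaussian factor. In [dom], the
    factor exp t + exp (- t) absorbs the linear factor that differentiation brings down. *)
Let M (N : R) : R := N * `|p| + N * `|q|.
Let D (N : R) : R := expR (c * (N ^+ 2 * p ^+ 2 + N ^+ 2 * q ^+ 2)).
Let dom (t : R) : R := expR (- (c / 2 * t ^+ 2) + t) + expR (- (c / 2 * t ^+ 2) + - t).

Let integrable_dom (C : R) : mu.-integrable [set: R] (EFin \o (fun t => C * dom t)).
Proof.
have c20 : 0 < c / 2 by rewrite divr_gt0.
have h1 := integrable_gaussian 1 c20.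
have h2 := integrable_gaussian (-1) c20.
have := integrableZl measurableT C (integrableD measurableT h1 h2).
apply: eq_integrable => // t _ /=.
by rewrite -EFinD -EFinM /dom mul1r mulN1r.
Qed.

(** Expanding (t - 2 tau p)^2 >= 0 gives (t - tau p)^2 >= t^2 / 2 - (tau p)^2; half of the Gaussian
    decay survives. *)
Let exponent_le (N tau t : R) : `|tau| <= N ->
  expR (- c * ((t - tau * p) ^+ 2 - (tau * q) ^+ 2)) <=
  D N * expR (- (c / 2 * t ^+ 2)).
Proof.
move=> tauN; rewrite /D -expRD ler_expR.
have t4 : tau ^+ 2 <= N ^+ 2.
  rewrite -[tau ^+ 2]ger0_norm ?sqr_ge0// normrX.
  by rewrite ler_sqr ?nnegrE// (le_trans _ tauN).
have : t ^+ 2 / 2 - N ^+ 2 * p ^+ 2 - N ^+ 2 * q ^+ 2 <=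
    (t - tau * p) ^+ 2 - (tau * q) ^+ 2.
  have h1 : tau ^+ 2 * p ^+ 2 <= N ^+ 2 * p ^+ 2 by rewrite ler_wpM2r ?sqr_ge0.
  have h2 : tau ^+ 2 * q ^+ 2 <= N ^+ 2 * q ^+ 2 by rewrite ler_wpM2r ?sqr_ge0.
  have h3' : 0 <= (t - 2 * (tau * p)) ^+ 2 by rewrite sqr_ge0.
  nra.
move/(ler_wpM2l (ltW c0)); nra.
Qed.

Let abs_le (t : R) : 1 + `|t| <= expR t + expR (- t).
Proof.
have h1 := expR_ge1Dx t; have h2 := expR_ge1Dx (- t).
have h3 := expR_gt0 t; have h4 := expR_gt0 (- t).
by case: (ger0P t) => _; lra.
Qed.

Let trig_le (N tau t a : R) : `|tau| <= N -> `|a| <= 1 ->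
  `|expR (- c * ((t - tau * p) ^+ 2 - (tau * q) ^+ 2)) * a| <=
  D N * expR (- (c / 2 * t ^+ 2)).
Proof.
move=> tauN a1; rewrite normrM ger0_norm ?expR_ge0//.
rewrite -[leRHS]mulr1 ler_pM ?expR_ge0//.
exact: exponent_le.
Qed.

(** Arbitrary [a] and [b] in [-1, 1] let one bound serve both [T_re] (cos and - sin) and [T_im] (sin
    and cos). *)
Let T_le (N tau t a b : R) : `|tau| <= N -> `|a| <= 1 -> `|b| <= 1 ->
  `|expR (- c * ((t - tau * p) ^+ 2 - (tau * q) ^+ 2)) *
  ((- (2 * c) * (t - tau * p)) * a + (2 * c * (tau * q)) * b)|
  <= (D N * (2 * c) * (1 + M N)) * dom t.
Proof.
move=> tauN a1 b1; rewrite normrM ger0_norm ?expR_ge0//.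
rewrite [leRHS](_ : _ = (D N * expR (- (c / 2 * t ^+ 2))) *
   ((2 * c) * (1 + M N) * (expR t + expR (- t)))); last first.
  by rewrite /dom !expRD; ring.
apply: ler_pM; rewrite ?expR_ge0 ?exponent_le//.
have N0 : 0 <= N by rewrite (le_trans _ tauN).
have M0 : 0 <= M N by rewrite addr_ge0// mulr_ge0.
apply: (@le_trans _ _ (2 * c * (`|t| + M N))); last first.
  rewrite -[leRHS]mulrA ler_pM2l ?mulr_gt0//.
  apply: (@le_trans _ _ ((1 + M N) * (1 + `|t|))).
    by have := normr_ge0 t; nra.
  by rewrite ler_pM2l ?abs_le// ltr_pwDl.
apply: (le_trans (ler_normD _ _)).
rewrite !normrM normrN normrM (ger0_norm (ltW c0)) (ger0_norm (ler0n R 2)).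
have h1 : `|t - tau * p| <= `|t| + N * `|p|.
  apply: (le_trans (ler_normB _ _)); rewrite lerD2l normrM.
  by rewrite ler_wpM2r.
have h2 : `|tau| * `|q| <= N * `|q| by rewrite ler_wpM2r.
have c20 : 0 < 2 * c by rewrite mulr_gt0.
rewrite /M addrA mulrDr lerD//.
  rewrite -[leLHS]mulrA ler_pM2l//.
  by apply: le_trans h1; rewrite ler_piMr.
rewrite -[leLHS]mulrA ler_pM2l//.
by apply: le_trans h2; rewrite ler_piMr// mulr_ge0.
Qed.

Let T_re_le N tau t : `|tau| <= N -> `|T_re tau t| <= (D N * (2 * c) * (1 + M N)) * dom t.
Proof.
move=> tauN.
have := @T_le N tau t (cos (2 * c * (t - tau * p) * (tau * q)))
  (- sin (2 * c * (t - tau * p) * (tau * q))) tauN (cos_max _).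
by rewrite mulrN normrN; apply; exact: sin_max.
Qed.

Let T_im_le N tau t : `|tau| <= N -> `|T_im tau t| <= (D N * (2 * c) * (1 + M N)) * dom t.
Proof. by move=> tauN; apply: T_le => //; [exact: sin_max|exact: cos_max]. Qed.

Let derivable_continuous (u v : R -> R) :
  (forall t : R, is_derive t (1:R) u (v t)) -> continuous u.
Proof.
move=> uv t; apply: differentiable_continuous; apply/derivable1_diffP.
by have [] := uv t.
Qed.

(** [T_re] is a combination of the two [gshift] functions with coefficients affine in t, hence
    differentiable. *)
Let continuous_T_re tau : continuous (T_re tau).
Proof.
have -> : T_re tau = fun t => (- (2 * c)) * (t - tau * p) * gshift_re tau t +
    (- (2 * c * (tau * q))) * gshift_im tau t.
  by apply/funext => t; rewrite /T_re /gshift_re /gshift_im; ring.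
exact: derivable_continuous.
Qed.

Let continuous_T_im tau : continuous (T_im tau).
Proof.
have -> : T_im tau = fun t => (- (2 * c)) * (t - tau * p) * gshift_im tau t +
    ((2 * c * (tau * q))) * gshift_re tau t.
  by apply/funext => t; rewrite /T_im /gshift_re /gshift_im; ring.
exact: derivable_continuous.
Qed.

Let integrable_continuous_le (u : R -> R) (v : R -> R) :
  continuous u -> (forall t, `|u t| <= v t) ->
  mu.-integrable [set: R] (EFin \o v) -> mu.-integrable [set: R] (EFin \o u).
Proof.
move=> cu uv; apply: le_integrable => //.
  by apply/measurable_EFinP; exact: continuous_measurable_fun.
move=> t _ /=; rewrite lee_fin (le_trans (uv t))//; exact: ler_norm.
Qed.

Let integrable_T_re tau : mu.-integrable [set: R] (EFin \o T_re tau).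
Proof.
apply: integrable_continuous_le (integrable_dom _); first exact: continuous_T_re.
by move=> t; apply: T_re_le.
Qed.

Let integrable_T_im tau : mu.-integrable [set: R] (EFin \o T_im tau).
Proof.
apply: integrable_continuous_le (integrable_dom _); first exact: continuous_T_im.
by move=> t; apply: T_im_le.
Qed.

(** Taking [s] to be 1 or -1 covers both ends of the line. Since exp y >= 1 + y, the bound decays at
    least like a constant over n + 1. *)
Let gauss_cvg0 (C : R) (u : R -> R) (s : R) : s ^+ 2 = 1 ->
  (forall t, `|u t| <= C * expR (- (c / 2 * t ^+ 2))) ->
  (fun n : nat => u (s * n%:R)) @ \oo --> (0 : R).
Proof.
move=> s1 uC; apply: norm_cvg0.
have gt0 : 0 < c / 2 by rewrite divr_gt0.
have : (fun n : nat => `|C| * (2 / c) * n.+1%:R^-1) @ \oo --> (0 : R).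
  rewrite -[X in _ --> X](mulr0 (`|C| * (2 / c))).
  by apply: cvgMr; exact: cvg_harmonic.
rewrite -(cvg_shiftS (fun n : nat => `|u (s * n%:R)|)).
apply: squeeze_cvgr; last exact: cvg_cst.
apply: nearW => n; rewrite normr_ge0/= (le_trans (uC _))//.
apply: (le_trans (ler_norm _)); rewrite normrM -[leRHS]mulrA; apply: ler_wpM2l => //.
rewrite ger0_norm ?expR_ge0// expRN exprMn s1 mul1r.
rewrite -[2 / c]invrK -invfM invf_div lef_pV2 ?posrE ?expR_gt0 ?mulr_gt0//.
apply: le_trans (expR_ge1Dx _).
rewrite ler_wpDl// ler_pM2l// -natrX ler_nat.
by rewrite expnS leq_pmulr// expn_gt0.
Qed.

Let integral_T_re tau : \int[mu]_t T_re tau t = 0.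
Proof.
apply: (integral_derivative_eq0 (is_derive_t_re tau)) => //.
- have := @gauss_cvg0 (D `|tau|) (gshift_re tau) 1.
  under eq_fun do rewrite mul1r.
  by apply; rewrite ?expr1n// => t; apply: trig_le => //; exact: cos_max.
- have := @gauss_cvg0 (D `|tau|) (gshift_re tau) (-1).
  under eq_fun do rewrite mulN1r.
  by apply; rewrite ?sqrrN ?expr1n// => t; apply: trig_le => //; exact: cos_max.
Qed.

Let integral_T_im tau : \int[mu]_t T_im tau t = 0.
Proof.
apply: (integral_derivative_eq0 (is_derive_t_im tau)) => //.
- have := @gauss_cvg0 (D `|tau|) (gshift_im tau) 1.
  under eq_fun do rewrite mul1r.
  by apply; rewrite ?expr1n// => t; apply: trig_le => //; exact: sin_max.
- have := @gauss_cvg0 (D `|tau|) (gshift_im tau) (-1).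
  under eq_fun do rewrite mulN1r.
  by apply; rewrite ?sqrrN ?expr1n// => t; apply: trig_le => //; exact: sin_max.
Qed.

Let integrable_gauss2 (C : R) :
  mu.-integrable [set: R] (EFin \o (fun t => C * expR (- (c / 2 * t ^+ 2)))).
Proof.
have c20 : 0 < c / 2 by rewrite divr_gt0.
have := integrableZl measurableT C (integrable_gaussian 0 c20).
by apply: eq_integrable => // t _ /=; rewrite mul0r addr0 EFinM.
Qed.

Lemma integrable_gshift_re tau : mu.-integrable [set: R] (EFin \o gshift_re tau).
Proof.
apply: integrable_continuous_le (integrable_gauss2 (D `|tau|)).
  exact: derivable_continuous (is_derive_t_re tau).
by move=> t; apply: trig_le => //; exact: cos_max.
Qed.

Lemma integrable_gshift_im tau : mu.-integrable [set: R] (EFin \o gshift_im tau).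
Proof.
apply: integrable_continuous_le (integrable_gauss2 (D `|tau|)).
  exact: derivable_continuous (is_derive_t_im tau).
by move=> t; apply: trig_le => //; exact: sin_max.
Qed.

(** Differentiation under the integral sign, on the neighbourhood ]- (|a| + 1), |a| + 1[ of a, where
    a single dominating function is available. *)
Let is_derive_integral (f df : R -> R -> R) (a C : R) :
  (forall tau, mu.-integrable [set: R] (EFin \o f tau)) ->
  (forall tau t, is_derive tau (1:R) (f^~ t) (df tau t)) ->
  (forall tau t, `|tau| <= `|a| + 1 -> `|df tau t| <= C * dom t) ->
  \int[mu]_t df a t = 0 ->
  is_derive a (1:R) (fun tau => \int[mu]_t f tau t) 0.
Proof.
move=> intf dfE dfC dfa.
have dE tau t : partial1of2 f tau t = df tau t.
  by rewrite partial1of2E; have h := dfE tau t; exact: derive_val.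
have aI : [set` `]- (`|a| + 1), `|a| + 1[] a.
  by rewrite /= in_itv/= -ltr_norml ltrDl.
have intf' x : [set` `]- (`|a| + 1), `|a| + 1[] x -> mu.-integrable [set: R] (EFin \o f x) by [].
have derf1 x y : [set` `]- (`|a| + 1), `|a| + 1[] x -> [set: R] y -> derivable (f ^~ y) x 1.
  by have [] := dfE x y.
(* The dominating function has to be nonnegative and the sign of [C] is unknown, hence [|C|]. *)
have G0 y : 0 <= `|C| * dom y by rewrite mulr_ge0// addr_ge0// expR_ge0.
have Gub x y : [set` `]- (`|a| + 1), `|a| + 1[] x -> [set: R] y ->
    `|partial1of2 f x y| <= `|C| * dom y.
  rewrite /= in_itv/= -ltr_norml => /ltW xa _; rewrite dE.
  rewrite (le_trans (dfC _ _ xa))// ler_wpM2r ?ler_norm// addr_ge0// expR_ge0//.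
have d := derivable_under_integral measurableT aI intf' derf1 G0 (integrable_dom _) Gub.
have v := differentiation_under_integral measurableT aI intf' derf1 G0 (integrable_dom _) Gub.
apply: DeriveDef => //.
rewrite -derive1E v -[RHS]dfa; apply: eq_Rintegral => t _; exact: dE.
Qed.

(* The derivative of exp (- c (t - tau (p + i q))^2) in tau is - (p + i q) times
   its derivative in t, so its integral vanishes. *)
Lemma integral_gshift_re :
  \int[mu]_t gshift_re 1 t = \int[mu]_t gshift_re 0 t.
Proof.
apply: (@is_derive_0_is_cst R (fun tau => \int[mu]_t gshift_re tau t)) => a.
pose B := D (`|a| + 1) * (2 * c) * (1 + M (`|a| + 1)).
apply: (is_derive_integral integrable_gshift_re is_derive_tau_re
  (C := `|p| * B + `|q| * B)) => [tau t taua|].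
  rewrite mulrDl -(mulrA `|p| B) -(mulrA `|q| B).
  apply: (le_trans (ler_normD _ _)); rewrite normrM normrN (normrM q) lerD// ler_wpM2l//.
    exact: (T_re_le _ taua).
  exact: (T_im_le _ taua).
rewrite RintegralD//.
- by rewrite !RintegralZl// integral_T_re integral_T_im !mulr0 addr0.
- by have := integrableZl measurableT (- p) (integrable_T_re a).
- by have := integrableZl measurableT q (integrable_T_im a).
Qed.

Lemma integral_gshift_im :
  \int[mu]_t gshift_im 1 t = \int[mu]_t gshift_im 0 t.
Proof.
apply: (@is_derive_0_is_cst R (fun tau => \int[mu]_t gshift_im tau t)) => a.
pose B := D (`|a| + 1) * (2 * c) * (1 + M (`|a| + 1)).
apply: (is_derive_integral integrable_gshift_im is_derive_tau_im
  (C := `|p| * B + `|q| * B)) => [tau t taua|].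
  rewrite mulrDl -(mulrA `|p| B) -(mulrA `|q| B).
  apply: (le_trans (ler_normB _ _)); rewrite normrM normrN (normrM q) lerD// ler_wpM2l//.
    exact: (T_im_le _ taua).
  exact: (T_re_le _ taua).
rewrite RintegralB//.
- by rewrite !RintegralZl// integral_T_re integral_T_im !mulr0 subr0.
- by have := integrableZl measurableT (- p) (integrable_T_im a).
- by have := integrableZl measurableT q (integrable_T_re a).
Qed.

End gaussian_shift.

(** * Square-integrable complex functions and the Gabor transform *)

Section complex_functions.
Context {R : realType}.
Implicit Types (z w : R[i]) (F G : R -> R[i]).
Let mu : {measure set (measurableTypeR R) -> \bar R} := @lebesgue_measure R.

(** The squared modulus as a real number: being polynomial in the components, it is within reach of
    [ring] and [nra]. *)
Definition csq z : R := complex.Re z ^+ 2 + complex.Im z ^+ 2.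

Lemma csq_ge0 z : 0 <= csq z.
Proof. by rewrite addr_ge0// sqr_ge0. Qed.

Lemma cnormE z : cnorm z = Num.sqrt (csq z).
Proof. by rewrite /cnorm normc_def. Qed.

Lemma sqr_cnorm z : cnorm z ^+ 2 = csq z.
Proof. by rewrite cnormE sqr_sqrtr// csq_ge0. Qed.

Lemma csqM z w : csq (z * w) = csq z * csq w.
Proof. by case: z => a b; case: w => c d; rewrite /csq /=; ring. Qed.

Lemma csqD z w : csq (z + w) <= 2 * csq z + 2 * csq w.
Proof.
case: z => a b; case: w => c d; rewrite /csq /=.
by have := sqr_ge0 (a - c); have := sqr_ge0 (b - d); nra.
Qed.

Lemma csq_real (x : R) : csq x%:C = x ^+ 2.
Proof. by rewrite /csq/= expr0n addr0. Qed.

Lemma csq_cis (a : R) : csq (cis a) = 1.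
Proof. by rewrite /csq/= cos2Dsin2. Qed.

Lemma cisD (a b : R) : cis (a + b) = cis a * cis b.
Proof. by apply/eqP; rewrite eq_complex /= cosD sinD eqxx addrC eqxx. Qed.

Lemma cis0 : cis 0 = 1 :> R[i].
Proof. by rewrite /cis cos0 sin0. Qed.

Lemma cis_neq0 (a : R) : cis a != 0.
Proof. by apply/eqP => /(congr1 csq); rewrite csq_cis csq_real expr0n => /eqP; rewrite oner_eq0. Qed.

Lemma ReM z w : complex.Re (z * w) =
  complex.Re z * complex.Re w - complex.Im z * complex.Im w.
Proof. by case: z => a b; case: w. Qed.

Lemma ImM z w : complex.Im (z * w) =
  complex.Re z * complex.Im w + complex.Im z * complex.Re w.
Proof. by case: z => a b; case: w. Qed.

Lemma ReD z w : complex.Re (z + w) = complex.Re z + complex.Re w.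
Proof. by case: z => a b; case: w. Qed.

Lemma ImD z w : complex.Im (z + w) = complex.Im z + complex.Im w.
Proof. by case: z => a b; case: w. Qed.

Lemma cmeasurable_cst z : cmeasurable (fun _ : R => z).
Proof. by split; exact: measurable_cst. Qed.

Lemma cmeasurableD F G : cmeasurable F -> cmeasurable G ->
  cmeasurable (fun t => F t + G t).
Proof.
move=> [F1 F2] [G1 G2]; split.
  by under eq_fun do rewrite ReD; exact: measurable_funD.
by under eq_fun do rewrite ImD; exact: measurable_funD.
Qed.

Lemma cmeasurableM F G : cmeasurable F -> cmeasurable G ->
  cmeasurable (fun t => F t * G t).
Proof.
move=> [F1 F2] [G1 G2]; split.
  by under eq_fun do rewrite ReM; apply: measurable_funB; exact: measurable_funM.
by under eq_fun do rewrite ImM; apply: measurable_funD; exact: measurable_funM.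
Qed.

Lemma cmeasurable_real (u : R -> R) : measurable_fun [set: R] u ->
  cmeasurable (fun t => (u t)%:C).
Proof. by move=> mu_; split => //=; exact: measurable_cst. Qed.

Lemma cmeasurable_cis (a : R) : cmeasurable (fun t => cis (a * t)).
Proof.
have ma : measurable_fun [set: R] (fun t : R => a * t) by exact: measurable_funM.
split => /=.
  by apply: measurableT_comp ma; apply: continuous_measurable_fun; exact: continuous_cos.
by apply: measurableT_comp ma; apply: continuous_measurable_fun; exact: continuous_sin.
Qed.

Lemma measurable_csq F : cmeasurable F -> measurable_fun [set: R] (fun t => csq (F t)).
Proof. by move=> [F1 F2]; apply: measurable_funD; exact: measurable_funX. Qed.

Lemma L2normE F : L2norm F = ((\int[mu]_t (csq (F t))%:E) `^ 2^-1)%E.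
Proof.
rewrite /L2norm unlock /Lnorm; congr (_ `^ _)%E.
apply: eq_integral => t _.
by rewrite /= ger0_norm ?cnormE ?sqrtr_ge0// -cnormE powR_mulrn ?cnormE ?sqrtr_ge0// -cnormE sqr_cnorm.
Qed.

(** A nonnegative extended real is finite exactly when its square root is. From here on, membership
    in L^2 is handled as integrability of [csq]. *)
Lemma L2P F : L2 R F <->
  cmeasurable F /\ mu.-integrable [set: R] (EFin \o (fun t => csq (F t))).
Proof.
have I0 : (0 <= \int[mu]_t (csq (F t))%:E)%E.
  by apply: integral_ge0 => t _; rewrite lee_fin csq_ge0.
have IE : (\int[mu]_t `|(csq (F t))%:E| = \int[mu]_t (csq (F t))%:E)%E.
  by apply: eq_integral => t _; rewrite /= ger0_norm// csq_ge0.
split=> [[mF FL]|[mF /integrableP[_ FL]]]; split => //.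
  apply/integrableP; split; first by apply/measurable_EFinP; exact: measurable_csq.
  rewrite /= IE; move: FL; rewrite L2normE.
  move: I0; case: (\int[mu]_t (csq (F t))%:E)%E => //= [r _ _|]; first by rewrite ltry.
  by rewrite invr_eq0 pnatr_eq0.
rewrite L2normE; rewrite /= IE in FL.
exact: poweR_lty.
Qed.

Lemma L2norm_lt F (e : R) : 0 < e ->
  (\int[mu]_t (csq (F t))%:E < (e ^+ 2)%:E)%E -> (L2norm F < e%:E)%E.
Proof.
move=> e0 Fe; rewrite L2normE.
have I0 : (0 <= \int[mu]_t (csq (F t))%:E)%E.
  by apply: integral_ge0 => t _; rewrite lee_fin csq_ge0.
move: I0 Fe; case: (\int[mu]_t (csq (F t))%:E)%E => // r; rewrite lee_fin lte_fin => r0 re.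
rewrite poweR_EFin lte_fin powR12_sqrt// -(ger0_norm (ltW e0)) -sqrtr_sqr.
by rewrite ltr_sqrt// exprn_gt0.
Qed.

Lemma L2D F G : L2 R F -> L2 R G -> L2 R (fun t => F t + G t).
Proof.
move=> /L2P[mF iF] /L2P[mG iG]; apply/L2P; split; first exact: cmeasurableD.
have := integrableD measurableT (integrableZl measurableT 2 iF) (integrableZl measurableT 2 iG).
apply: le_integrable => //.
  by apply/measurable_EFinP; apply: measurable_csq; exact: cmeasurableD.
move=> t _ /=; rewrite lee_fin !ger0_norm ?csq_ge0 ?addr_ge0 ?mulr_ge0 ?csq_ge0//.
exact: csqD.
Qed.

Lemma L2Z z F : L2 R F -> L2 R (fun t => z * F t).
Proof.
move=> /L2P[mF iF]; apply/L2P; split.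
  by apply: cmeasurableM => //; exact: cmeasurable_cst.
have := integrableZl measurableT (csq z) iF.
by apply: eq_integrable => // t _ /=; rewrite csqM EFinM.
Qed.

Definition cintegrable F : Prop :=
  mu.-integrable [set: R] (EFin \o (fun t => complex.Re (F t))) /\
  mu.-integrable [set: R] (EFin \o (fun t => complex.Im (F t))).

Lemma cintegralD F G : cintegrable F -> cintegrable G ->
  cintegral (fun t => F t + G t) = cintegral F + cintegral G.
Proof.
move=> [F1 F2] [G1 G2]; rewrite /cintegral.
under eq_Rintegral do rewrite ReD.
under [X in _ +i* X]eq_Rintegral do rewrite ImD.
by rewrite !RintegralD.
Qed.

Lemma cintegralZ z F : cintegrable F ->
  cintegral (fun t => z * F t) = z * cintegral F.
Proof.
move=> [F1 F2]; rewrite /cintegral.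
under eq_Rintegral do rewrite ReM.
under [X in _ +i* X]eq_Rintegral do rewrite ImM.
have Z (a : R) (u : R -> R) : mu.-integrable [set: R] (EFin \o u) ->
    mu.-integrable [set: R] (EFin \o (fun t => a * u t)).
  move=> iu; have := integrableZl measurableT a iu.
  by apply: eq_integrable => // t _ /=; rewrite EFinM.
rewrite RintegralB ?RintegralD ?RintegralZl//; try exact: Z.
by case: z => a b.
Qed.

(** Both components of z w are bounded by |z|^2 + |w|^2. With [L2_gwin], this makes every integral
    in the Gabor transform of an L^2 function a genuine one. *)
Lemma cintegrable_L2M F G : L2 R F -> L2 R G -> cintegrable (fun t => F t * G t).
Proof.
move=> /L2P[mF iF] /L2P[mG iG].
have [m1 m2] := cmeasurableM mF mG.
have iFG := integrableD measurableT iF iG.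
have h (z w : R[i]) : `|complex.Re (z * w)| <= csq z + csq w /\
    `|complex.Im (z * w)| <= csq z + csq w.
  case: z => a b; case: w => c d; rewrite /csq /=.
  have [h1 h2 h3 h4] : [/\ 0 <= (a - c) ^+ 2, 0 <= (a + c) ^+ 2,
      0 <= (b - d) ^+ 2 & 0 <= (b + d) ^+ 2] by rewrite !sqr_ge0.
  have [h5 h6 h7 h8] : [/\ 0 <= (a - d) ^+ 2, 0 <= (a + d) ^+ 2,
      0 <= (b - c) ^+ 2 & 0 <= (b + c) ^+ 2] by rewrite !sqr_ge0.
  by rewrite !ler_norml; split; apply/andP; split; nra.
split; apply: le_integrable iFG => //.
- exact/measurable_EFinP.
- move=> t _ /=; rewrite lee_fin; have [+ _] := h (F t) (G t).
  by move/le_trans; apply; exact: ler_norm.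
- exact/measurable_EFinP.
- move=> t _ /=; rewrite lee_fin; have [_ +] := h (F t) (G t).
  by move/le_trans; apply; exact: ler_norm.
Qed.

Lemma ae_sub (P Q : R -> Prop) : (forall t, P t -> Q t) ->
  {ae @lebesgue_measure R, forall t, P t} -> {ae @lebesgue_measure R, forall t, Q t}.
Proof. by move=> PQ; apply: negligibleS => t /=; apply: contra_not; exact: PQ. Qed.

Lemma ae_eq_cintegral F G : cmeasurable F -> cmeasurable G ->
  {ae mu, forall t, F t = G t} -> cintegral F = cintegral G.
Proof.
move=> [F1 F2] [G1 G2] FG; rewrite /cintegral /Rintegral.
congr (fine _ +i* fine _); apply: ae_eq_integral => //.
- exact/measurable_EFinP.
- exact/measurable_EFinP.
- by apply: ae_sub FG => t -> _.
- exact/measurable_EFinP.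
- exact/measurable_EFinP.
- by apply: ae_sub FG => t -> _.
Qed.

(** * The Gabor transform as a pairing with L^2 functions *)

Definition gwin (x w t : R) : R[i] :=
  (expR (- (pi * (t - x) ^+ 2)))%:C * cis (- (2 * pi * t * w)).

Lemma gaborE F (x w : R) : gabor F x w = (2 `^ 4^-1)%:C * cintegral (fun t => F t * gwin x w t).
Proof.
rewrite /gabor; congr (_ * cintegral _).
by apply/funext => t; rewrite /gwin mulrA.
Qed.

Lemma L2_gwin (x w : R) : L2 R (gwin x w).
Proof.
apply/L2P; split.
  apply: cmeasurableM.
    apply: cmeasurable_real; apply: continuous_measurable_fun => t.
    apply: (continuous_comp (f := fun t : R => - (pi * (t - x) ^+ 2)) (g := expR)); last exact: continuous_expR.
    by apply: cvgN; apply: cvgMr; apply: cvgM; apply: cvgB => //; apply: cvg_cst.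
  have -> : (fun t => cis (- (2 * pi * t * w))) = (fun t => cis (- (2 * pi * w) * t)) :> (R -> R[i]).
    by apply/funext => t; congr cis; ring.
  exact: cmeasurable_cis.
have p0 : (0 : R) < 2 * pi by rewrite mulr_gt0 ?pi_gt0.
have := integrableZl measurableT (expR (- (2 * pi * x ^+ 2))) (integrable_gaussian (4 * pi * x) p0).
apply: eq_integrable => // t _ /=.
rewrite csqM csq_cis csq_real mulr1 -EFinM [expR (- (pi * _)) ^+ 2]expr2 -!expRD; congr (expR _)%:E.
ring.
Qed.

Lemma gaborD F G (x w : R) : L2 R F -> L2 R G ->
  gabor (fun t => F t + G t) x w = gabor F x w + gabor G x w.
Proof.
move=> LF LG; rewrite !gaborE -mulrDr -cintegralD; last 2 first.
- exact: (cintegrable_L2M LF (L2_gwin x w)).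
- exact: (cintegrable_L2M LG (L2_gwin x w)).
by congr (_ * cintegral _); apply/funext => t; rewrite mulrDl.
Qed.

Lemma gaborZ z F (x w : R) : L2 R F -> gabor (fun t => z * F t) x w = z * gabor F x w.
Proof.
move=> LF; rewrite !gaborE mulrCA -(cintegralZ z (cintegrable_L2M LF (L2_gwin x w))).
by congr (_ * cintegral _); apply/funext => t; rewrite mulrA.
Qed.

(** This carries [phase_equiv], an almost everywhere relation, over to pointwise equations between
    transforms. *)
Lemma ae_eq_gabor F G (x w : R) : L2 R F -> L2 R G -> {ae mu, forall t, F t = G t} ->
  gabor F x w = gabor G x w.
Proof.
move=> [mF _] [mG _] FG; rewrite !gaborE; congr (_ * _).
have [mw _] := L2_gwin x w.
apply: ae_eq_cintegral; [exact: cmeasurableM|exact: cmeasurableM|].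
by apply: ae_sub FG => t ->.
Qed.

(** * Explicit transforms of modulated Gaussians *)

Lemma integral_gaussian_gt0 (c : R) : 0 < c ->
  0 < \int[mu]_t expR (- (c * t ^+ 2)).
Proof.
move=> c0; pose s := Num.sqrt (2 * c)^-1.
have s2 : s ^+ 2 = (2 * c)^-1 by rewrite sqr_sqrtr// invr_ge0 mulr_ge0// ltW.
have s0 : s != 0 by rewrite gt_eqF// sqrtr_gt0 invr_gt0 mulr_gt0.
have -> : \int[mu]_t expR (- (c * t ^+ 2)) = \int[mu]_t ((normal_peak s)^-1 * normal_pdf 0 s t).
  apply: eq_Rintegral => t _; rewrite normal_pdfE// mulKf ?gt_eqF ?normal_peak_gt0//.
  by rewrite /normal_fun s2; congr expR; field; rewrite gt_eqF.
rewrite RintegralZl//; last exact: integrable_normal_pdf.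
by rewrite /Rintegral integral_normal_pdf mulr1 invr_gt0 normal_peak_gt0.
Qed.

Definition gaussK : R := \int[mu]_t expR (- (2 * pi * t ^+ 2)).

(* exp (- pi t^2 + 2 pi (m + i l) t) *)
Definition psi (m l t : R) : R[i] :=
  (expR (- (pi * t ^+ 2) + 2 * pi * m * t))%:C * cis (2 * pi * l * t).

Lemma L2_psi (m l : R) : L2 R (psi m l).
Proof.
apply/L2P; split.
  apply: cmeasurableM; last exact: cmeasurable_cis.
  apply: cmeasurable_real; apply: continuous_measurable_fun => t.
  apply: (continuous_comp (f := fun t : R => - (pi * t ^+ 2) + 2 * pi * m * t) (g := expR)); last exact: continuous_expR.
  apply: cvgD; last by apply: cvgMr.
  by apply: cvgN; apply: cvgMr; apply: cvgM.
have p0 : (0 : R) < 2 * pi by rewrite mulr_gt0 ?pi_gt0.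
have := integrable_gaussian (4 * pi * m) p0.
apply: eq_integrable => // t _ /=.
rewrite csqM csq_cis csq_real mulr1 (expr2 (expR _)) -!expRD; congr (expR _)%:E.
ring.
Qed.

(** With zeta = (x + m) + i (l - w), completing the square gives the integrand exp (- pi x^2 + pi
    zeta^2 / 2) exp (- 2 pi (t - zeta / 2)^2). The complex shift zeta / 2 = p + i q does not change
    the integral, which is [gaussK]. *)
Lemma gabor_psi (m l x w : R) : gabor (psi m l) x w =
  (2 `^ 4^-1 * gaussK)%:C *
  ((expR (- (pi * x ^+ 2) + pi / 2 * ((x + m) ^+ 2 - (l - w) ^+ 2)))%:C *
  cis (pi * (x + m) * (l - w))).
Proof.
rewrite gaborE rmorphM -!mulrA; congr (_ * _).
pose p := (x + m) / 2; pose q := (l - w) / 2; pose c : R := 2 * pi.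
have c0 : 0 < c by rewrite mulr_gt0 ?pi_gt0.
pose A := expR (- (pi * x ^+ 2) + pi / 2 * ((x + m) ^+ 2 - (l - w) ^+ 2)).
have -> : (fun t => psi m l t * gwin x w t) = (fun t =>
    (A%:C * cis (pi * (x + m) * (l - w))) * (gshift_re c p q 1 t +i* gshift_im c p q 1 t)).
  apply/funext => t.
  have -> : gshift_re c p q 1 t +i* gshift_im c p q 1 t =
      (expR (- c * ((t - p) ^+ 2 - q ^+ 2)))%:C * cis (2 * c * (t - p) * q).
    by rewrite /gshift_re /gshift_im /cis !mul1r; apply/eqP; rewrite eq_complex /= !mul0r subr0 addr0 !eqxx.
  rewrite /psi /gwin mulrACA -rmorphM -cisD -expRD [RHS]mulrACA -rmorphM -cisD /A -expRD.
  by congr ((expR _)%:C * cis _); rewrite /p /q /c; field.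
rewrite cintegralZ; last first.
  by split; [exact: integrable_gshift_re|exact: integrable_gshift_im].
rewrite mulrC; congr (_ * _).
transitivity (gaussK +i* 0); last exact: erefl.
rewrite /cintegral.
congr (_ +i* _).
  apply: (etrans (integral_gshift_re p q c0)).
  apply: eq_Rintegral => t _; rewrite /gshift_re !mul0r mulr0 cos0 mulr1.
  by congr expR; rewrite /c; ring.
apply: (etrans (integral_gshift_im p q c0)).
under eq_Rintegral do rewrite /gshift_im !mul0r mulr0 sin0 mulr0.
by rewrite /Rintegral integral0.
by rewrite /A -!mulrA.
Qed.

Lemma gabor_psi_neq0 (m l x w : R) : gabor (psi m l) x w != 0.
Proof.
have rc (a : R) : 0 < a -> a%:C != 0 by move=> a0; rewrite eq_complex /= negb_and gt_eqF.
rewrite gabor_psi !mulf_neq0 ?cis_neq0// rc ?expR_gt0// mulr_gt0 ?powR_gt0//.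
by rewrite integral_gaussian_gt0// mulr_gt0// pi_gt0.
Qed.

(* exp (2 pi s (x - i w) + i pi r) with 2 s = - q + i p. *)
Definition mult (p q r x w : R) : R[i] :=
  (expR (pi * (p * w - q * x)))%:C * cis (pi * (p * x + q * w + r)).

(** The constant [k] is the quotient of the two explicit exponentials, from which x and w cancel. *)
Lemma gabor_psi_shift (p q r l : R) : exists k : R[i], forall x w : R,
  k * gabor (psi (- q) (l + p)) x w = mult p q r x w * gabor (psi 0 l) x w.
Proof.
exists ((expR (- (pi / 2) * (q ^+ 2 - 2 * p * l - p ^+ 2)))%:C *
  cis (pi * r + pi * q * (l + p))) => x w.
rewrite !gabor_psi mulrCA [RHS]mulrCA /mult; congr (_ * _).
rewrite mulrACA -rmorphM -cisD -expRD [RHS]mulrACA -rmorphM -cisD -expRD.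
by congr ((expR _)%:C * cis _); field.
Qed.

End complex_functions.

(** * Density of the span of modulated Gaussians *)

Section one_variable_limits.
Context {R : realType}.

(** Write y = z^2: then n y^n = (n z^n) z^n, where n z^n stays bounded by 1 / (1 - z) and z^n tends
    to 0. *)
Lemma cvg_natM_expr (y : R) : 0 <= y < 1 ->
  (fun n => n%:R * y ^+ n) @ \oo --> (0 : R).
Proof.
move=> /andP[y0 y1]; pose z := Num.sqrt y.
have z0 : 0 <= z by rewrite sqrtr_ge0.
have zy : z ^+ 2 = y by rewrite sqr_sqrtr.
have z1 : z < 1 by rewrite ltNge; apply/negP => z1; nra.
(* In other terms, n z^n <= 1 + z + ... + z^(n-1), each term of the sum being at least z^n. *)
have h n : n%:R * z ^+ n * (1 - z) <= 1 - z ^+ n.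
  elim: n => [|n IH]; first by rewrite !mul0r expr0 subrr.
  have zn0 : 0 <= z ^+ n by rewrite exprn_ge0.
  have zn1 : z ^+ n <= 1 by rewrite exprn_ile1// ltW.
  rewrite -natr1 exprS; move: IH; set a := z ^+ n; set N := n%:R => IH.
  have : z * (N * a * (1 - z)) <= z * (1 - a) by rewrite ler_wpM2l.
  have : 0 <= (1 - z) * (1 - z * a).
    by rewrite mulr_ge0 ?subr_ge0 ?mulr_ile1// ltW.
  lra.
apply: (@squeeze_cvgr _ _ _ _ (cst 0) (fun n => (1 - z)^-1 * z ^+ n)); last 2 first.
- exact: cvg_cst.
- rewrite -[X in _ --> X](mulr0 (1 - z)^-1); apply: cvgMr.
  by apply: cvg_expr; rewrite ger0_norm.
apply: nearW => n; rewrite mulr_ge0 ?exprn_ge0//=.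
rewrite -zy -exprM mulnC exprM expr2 mulrA ler_wpM2r ?exprn_ge0//.
rewrite -[leRHS]mul1r ler_pdivlMr ?subr_gt0//.
by apply: le_trans (h n) _; rewrite gerBl exprn_ge0.
Qed.

Lemma bernoulli_inequality (a : R) n : 0 <= a <= 1 -> 1 - n%:R * a <= (1 - a) ^+ n.
Proof.
move=> /andP[a0 a1]; elim: n => [|n IH]; first by rewrite mul0r subr0 expr0.
rewrite exprS -natr1.
have : (1 - a) * (1 - n%:R * a) <= (1 - a) * (1 - a) ^+ n.
  by rewrite ler_wpM2l// subr_ge0.
have : 0 <= n%:R * a ^+ 2 :> R by rewrite mulr_ge0// sqr_ge0.
nra.
Qed.

(* The Brosowski-Deutsch polynomials; the extra factor [m] in the exponent
   forces convergence also at [x = 1/2]. *)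
Definition bd_poly (m : nat) (x : R) : R := (1 - x ^+ m) ^+ (m * 2 ^ m).

Lemma bd_poly_itv m x : 0 <= x <= 1 -> 0 <= bd_poly m x <= 1.
Proof.
move=> /andP[x0 x1].
have h : 0 <= 1 - x ^+ m <= 1 by rewrite subr_ge0 exprn_ile1//= gerBl exprn_ge0.
by rewrite /bd_poly; move/andP: h => [h1 h2]; rewrite exprn_ge0//= exprn_ile1.
Qed.

(** The Bernoulli inequality bounds the polynomial below by 1 - m (2 x)^m, where 2 x < 1. *)
Lemma cvg_bd_poly_lt x : 0 <= x < 2^-1 -> bd_poly ^~ x @ \oo --> (1 : R).
Proof.
move=> /andP[x0 x2].
apply: (@squeeze_cvgr _ _ _ _ (fun m => 1 - m%:R * (2 * x) ^+ m) (cst 1)); last 2 first.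
- rewrite -[X in _ --> X](subr0 1); apply: cvgB; first exact: cvg_cst.
  by apply: cvg_natM_expr; apply/andP; split; lra.
- exact: cvg_cst.
have x01 : 0 <= x <= 1 by apply/andP; split; lra.
apply: nearW => m; have /andP[_ ->] := bd_poly_itv m x01; rewrite andbT.
rewrite /bd_poly; apply: le_trans (bernoulli_inequality _ _); last first.
  by rewrite exprn_ge0//= exprn_ile1//; case/andP: x01.
by rewrite exprMn natrM natrX mulrA.
Qed.

(** From 1 - u <= exp (- u), the value is at most exp (- m (2 x)^m) <= exp (- m), as 2 x >= 1. *)
Lemma cvg_bd_poly_ge x : 2^-1 <= x <= 1 -> bd_poly ^~ x @ \oo --> (0 : R).
Proof.
move=> /andP[x2 x1]; have x0 : 0 <= x by lra.
have x01 : 0 <= x <= 1 by rewrite x0.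
apply: (@squeeze_cvgr _ _ _ _ (cst 0) (fun m => expR (- m%:R))); last 2 first.
- exact: cvg_cst.
- have -> : (fun m => expR (- m%:R)) = (fun m => (expR (- 1)) ^+ m) :> (nat -> R).
    by apply/funext => m; rewrite -expRM_natl mulrN1.
  by apply: cvg_expr; rewrite ger0_norm ?expR_ge0// expR_lt1 oppr_lt0.
apply: nearW => m; have /andP[-> _] /= := bd_poly_itv m x01.
apply: (@le_trans _ _ (expR (- x ^+ m) ^+ (m * 2 ^ m))).
  rewrite /bd_poly lerXn2r ?nnegrE ?expR_ge0 ?subr_ge0 ?exprn_ile1//.
  exact: expR_ge1Dx.
rewrite -expRM_natl ler_expR mulrN lerN2 natrM natrX -mulrA -exprMn ler_peMr//.
by rewrite exprn_ege1//; lra.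
Qed.

End one_variable_limits.

(** * The L^2 closure of a subspace containing the modulated Gaussians *)

Section approximation.
Context {R : realType}.
Let mu : {measure set (measurableTypeR R) -> \bar R} := @lebesgue_measure R.
Implicit Types (F G : R -> R[i]) (u v : R -> R).

Lemma integral_csqD_le F G : cmeasurable F -> cmeasurable G ->
  (\int[mu]_t (csq (F t + G t))%:E <=
   2%:E * \int[mu]_t (csq (F t))%:E + 2%:E * \int[mu]_t (csq (G t))%:E)%E.
Proof.
move=> mF mG.
have mE H : cmeasurable H -> measurable_fun [set: R] (fun t => (csq (H t))%:E).
  by move=> mH; apply/measurable_EFinP; exact: measurable_csq.
have p H t : (0 <= (csq (H t : R[i]))%:E)%E by rewrite lee_fin csq_ge0.
rewrite -!ge0_integralZl_EFin//; [|exact: mE|exact: mE].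
rewrite -ge0_integralD//; last 4 first.
- by move=> t _; rewrite mule_ge0.
- by apply: measurable_funeM; exact: mE.
- by move=> t _; rewrite mule_ge0.
- by apply: measurable_funeM; exact: mE.
apply: ge0_le_integral => //.
- by apply: mE; exact: cmeasurableD.
- by apply: emeasurable_funD; apply: measurable_funeM; exact: mE.
- by move=> t _; rewrite -!EFinM -EFinD lee_fin csqD.
Qed.

Lemma integral_csqZ (z : R[i]) F : cmeasurable F ->
  (\int[mu]_t (csq (z * F t))%:E = (csq z)%:E * \int[mu]_t (csq (F t))%:E)%E.
Proof.
move=> mF; rewrite -ge0_integralZl_EFin//.
- by apply: eq_integral => t _; rewrite csqM EFinM.
- by move=> t _; rewrite lee_fin csq_ge0.
- by apply/measurable_EFinP; exact: measurable_csq.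
- exact: csq_ge0.
Qed.

(** An arbitrary complex subspace of L^2, later taken to be [has_partner p q r]. *)
Variable S : (R -> R[i]) -> Prop.
Hypothesis S_L2 : forall F, S F -> L2 R F.
Hypothesis SD : forall F G, S F -> S G -> S (fun t => F t + G t).
Hypothesis SZ : forall z F, S F -> S (fun t => z * F t).

(** The L^2 closure of [S], expressed with squared norms so that no square root occurs. *)
Definition approx_by F : Prop := cmeasurable F /\
  forall e : R, 0 < e -> exists2 k, S k & (\int[mu]_t (csq (F t - k t))%:E < e%:E)%E.

Let S_cmeasurable F : S F -> cmeasurable F. Proof. by move=> /S_L2[]. Qed.

Let cmeasurableB F G : cmeasurable F -> cmeasurable G -> cmeasurable (fun t => F t - G t).
Proof.
move=> mF mG; have -> : (fun t => F t - G t) = (fun t => F t + (-1) * G t).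
  by apply/funext => t; rewrite mulN1r.
apply: cmeasurableD => //; apply: cmeasurableM => //; exact: cmeasurable_cst.
Qed.

Lemma approx_by_mem F : S F -> approx_by F.
Proof.
move=> SF; split; first exact: S_cmeasurable.
move=> e e0; exists F => //.
under eq_integral do rewrite subrr csq_real expr0n.
by rewrite integral0 lte_fin.
Qed.

Lemma approx_by_close F : cmeasurable F ->
  (forall e : R, 0 < e -> exists2 G, approx_by G &
     (\int[mu]_t (csq (F t - G t))%:E < e%:E)%E) -> approx_by F.
Proof.
move=> mF FG; split => // e e0.
(* The bound |z + w|^2 <= 2 |z|^2 + 2 |w|^2 turns two errors below e / 4 into one below e. *)
have e4 : 0 < e / 4 by rewrite divr_gt0.
have [G [mG Gk] FGe] := FG _ e4.
have [k Sk Gke] := Gk _ e4; exists k => //.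
have mk := S_cmeasurable Sk.
have -> : (fun t => (csq (F t - k t))%:E) = (fun t => (csq ((F t - G t) + (G t - k t)))%:E).
  by apply/funext => t; rewrite addrA subrK.
apply: le_lt_trans (integral_csqD_le (cmeasurableB mF mG) (cmeasurableB mG mk)) _.
have -> : e%:E = (2%:E * (e / 4)%:E + 2%:E * (e / 4)%:E)%E.
  by rewrite -!EFinM -EFinD; congr (_%:E); field.
by rewrite lteD// lte_pmul2l.
Qed.

Lemma approx_byD F G : approx_by F -> approx_by G -> approx_by (fun t => F t + G t).
Proof.
move=> [mF Fk] [mG Gl]; split => [|e e0]; first exact: cmeasurableD.
have e4 : 0 < e / 4 by rewrite divr_gt0.
have [k Sk Fke] := Fk _ e4; have [l Sl Gle] := Gl _ e4.
exists (fun t => k t + l t); first exact: SD.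
have -> : (fun t => (csq (F t + G t - (k t + l t)))%:E) =
    (fun t => (csq ((F t - k t) + (G t - l t)))%:E).
  by apply/funext => t; rewrite opprD addrACA.
have mk := S_cmeasurable Sk; have ml := S_cmeasurable Sl.
apply: le_lt_trans (integral_csqD_le (cmeasurableB mF mk) (cmeasurableB mG ml)) _.
have -> : e%:E = (2%:E * (e / 4)%:E + 2%:E * (e / 4)%:E)%E.
  by rewrite -!EFinM -EFinD; congr (_%:E); field.
by rewrite lteD// lte_pmul2l.
Qed.

Lemma approx_byZ (z : R[i]) F : approx_by F -> approx_by (fun t => z * F t).
Proof.
move=> [mF Fk]; split => [|e e0]; first by apply: cmeasurableM => //; exact: cmeasurable_cst.
(* Adding 1 keeps the divisor positive when z = 0. *)
have c0 : 0 < csq z + 1 by rewrite ltr_wpDl// csq_ge0.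
have ec : 0 < e / (csq z + 1) by rewrite divr_gt0.
have [k Sk Fke] := Fk _ ec.
exists (fun t => z * k t); first exact: SZ.
have mk := S_cmeasurable Sk.
under eq_integral do rewrite -mulrBr.
rewrite integral_csqZ; last exact: cmeasurableB.
apply: (@le_lt_trans _ _ ((csq z + 1)%:E * \int[mu]_t (csq (F t - k t))%:E)%E).
  rewrite lee_wpmul2r ?lee_fin ?lerDl//.
  by apply: integral_ge0 => t _; rewrite lee_fin csq_ge0.
have -> : e%:E = ((csq z + 1)%:E * (e / (csq z + 1))%:E)%E.
  by rewrite -EFinM mulrC divfK// gt_eqF.
by rewrite lte_pmul2l.
Qed.

(** Dominated convergence applied to the squared differences gives convergence in L^2, and the
    closure is closed. *)
Lemma approx_by_cvg (u_ : nat -> R -> R) u (W : R -> R) :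
  (forall n, approx_by (fun t => (u_ n t)%:C)) ->
  (forall t, u_ ^~ t @ \oo --> u t) ->
  mu.-integrable [set: R] (EFin \o W) ->
  (forall n t, (u t - u_ n t) ^+ 2 <= W t) ->
  approx_by (fun t => (u t)%:C).
Proof.
move=> au uu iW uW.
have mu_ n : measurable_fun [set: R] (u_ n) by have [[]] := au n.
have mu0 : measurable_fun [set: R] u.
  exact: (measurable_fun_cvg mu_ (fun t _ => uu t)).
apply: approx_by_close; first exact: cmeasurable_real.
move=> e e0.
pose f n t := ((u t - u_ n t) ^+ 2)%:E.
have mf n : measurable_fun [set: R] (f n).
  by apply/measurable_EFinP; apply: measurable_funX; exact: measurable_funB.
have f0 : {ae mu, forall t, [set: R] t -> f ^~ t @ \oo --> (cst 0%E) t}.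
  apply: aeW => t _; apply: cvg_EFin; first exact: nearW.
  rewrite /= [X in _ --> X](_ : 0 = (u t - u t) * (u t - u t)); last by rewrite subrr mul0r.
  rewrite /comp /=; under eq_fun do rewrite expr2.
  by apply: cvgM; apply: cvgB => //; apply: cvg_cst.
have fW : {ae mu, forall t n, [set: R] t -> (`|f n t| <= (EFin \o W) t)%E}.
  by apply: aeW => t n _; rewrite /f /= lee_fin ger0_norm ?sqr_ge0.
have [_ _ cf] := @dominated_convergence _ _ _ mu setT measurableT f (cst 0%E)
   (EFin \o W) mf (measurable_cst _) f0 iW fW.
rewrite integral0 in cf.
have /cf [N _ /(_ N (leqnn N)) /=] : nbhs 0%E [set x : \bar R | (x < e%:E)%E].
  exact: lt_nbhsl.
move=> fNe; exists (fun t => (u_ N t)%:C) => //.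
apply: le_lt_trans fNe; apply: ge0_le_integral => //.
- by move=> t _; rewrite lee_fin csq_ge0.
- by apply/measurable_EFinP; apply: measurable_csq; apply: cmeasurableB; exact: cmeasurable_real.
- exact: mf.
- by move=> t _; rewrite lee_fin -rmorphB csq_real.
Qed.

Hypothesis S_psi : forall l, S (psi 0 l).

(* Quantifying over all frequencies l makes T stable under multiplication by
   cosines. *)
Let T (h : R -> R) : Prop := forall l, S (fun t => (h t)%:C * psi 0 l t).

Let eqS F G : F =1 G -> S F -> S G.
Proof. by move=> /funext ->. Qed.

Let T1 : T (cst 1).
Proof. by move=> l; apply: eqS (S_psi l) => t; rewrite mul1r. Qed.

Let TD h1 h2 : T h1 -> T h2 -> T (fun t => h1 t + h2 t).
Proof.
move=> T1' T2 l; apply: eqS (SD (T1' l) (T2 l)) => t.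
by rewrite rmorphD mulrDl.
Qed.

Let TZ (a : R) h : T h -> T (fun t => a * h t).
Proof.
move=> Th l; apply: eqS (SZ a%:C (Th l)) => t.
by rewrite rmorphM mulrA.
Qed.

Let psi_cis (l a t : R) : cis (2 * pi * a * t) * psi 0 l t = psi 0 (l + a) t.
Proof.
rewrite /psi mulrCA -cisD; congr (_ * cis _); ring.
Qed.

Let cos_cis (a : R) : (cos a)%:C = 2^-1%:C * (cis a + cis (- a)) :> R[i].
Proof.
apply/eqP; rewrite eq_complex /= cosN sinN; apply/andP; split; apply/eqP; lra.
Qed.

(** By Euler's formula the cosine averages two modulations, which move the frequency l to l + a and
    l - a. *)
Let Tcos (a b : R) h : T h -> T (fun t => cos (2 * pi * a * t + b) * h t).
Proof.
move=> Th l.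
have := SD (SZ (2^-1%:C * cis b) (Th (l + a))) (SZ (2^-1%:C * cis (- b)) (Th (l - a))).
apply: eqS => t.
rewrite -(psi_cis l a t) -(psi_cis l (- a) t).
have -> : (cos (2 * pi * a * t + b) * h t)%:C =
    (cos (2 * pi * a * t + b))%:C * (h t)%:C :> R[i] by exact: rmorphM.
rewrite cos_cis opprD !cisD mulrN mulNr; ring.
Qed.

(** This is (1 - sin (2 pi a (t - x))) / 2, written with a cosine so that [Tcos] applies. It takes
    values in [0, 1] and is below 1/2 exactly where the sine is positive. *)
Let q (a x t : R) : R := 2^-1 + 2^-1 * cos (2 * pi * a * (t - x) + pi / 2).

Let qE a x t : q a x t = 2^-1 - 2^-1 * sin (2 * pi * a * (t - x)).
Proof. by rewrite /q cosDpihalf mulrN. Qed.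

Let q_itv a x t : 0 <= q a x t <= 1.
Proof.
rewrite qE; have := sin_le1 (2 * pi * a * (t - x)).
have := sin_geN1 (2 * pi * a * (t - x)) => h1 h2.
by apply/andP; split; lra.
Qed.

Let Tq a x h : T h -> T (fun t => q a x t * h t).
Proof.
move=> Th l.
apply: eqS (TD (TZ 2^-1 Th) (TZ 2^-1 (Tcos a (- (2 * pi * a * x) + pi / 2) Th)) l) => t.
congr (_%:C * _); rewrite /q.
have -> : 2 * pi * a * t + (- (2 * pi * a * x) + pi / 2) = 2 * pi * a * (t - x) + pi / 2.
  by ring.
by ring.
Qed.

Let TM (r : R -> R) : (forall h, T h -> T (fun t => r t * h t)) ->
  forall n h, T h -> T (fun t => r t ^+ n * h t).
Proof.
move=> Tr; elim=> [|n IH] h Th.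
  by move=> l; apply: eqS (Th l) => t; rewrite expr0 mul1r.
by move=> l; apply: eqS (Tr _ (IH _ Th) l) => t; rewrite exprS mulrA.
Qed.

Let T_bd_poly m a x : T (fun t => bd_poly m (q a x t)).
Proof.
have TqN h : T h -> T (fun t => (1 - q a x t ^+ m) * h t).
  move=> Th l.
  apply: eqS (TD Th (TZ (-1) (TM (@Tq a x) m Th)) l) => t.
  by congr (_%:C * _); rewrite mulrBl mul1r mulN1r.
by move=> l; apply: eqS (TM TqN (m * 2 ^ m) T1 l) => t; rewrite mulr1.
Qed.

Definition gauss (t : R) : R := expR (- (pi * t ^+ 2)).

Lemma integrable_gauss_sqr : mu.-integrable [set: R] (EFin \o (fun t => gauss t ^+ 2)).
Proof.
have p0 : (0 : R) < 2 * pi by rewrite mulr_gt0 ?pi_gt0.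
have := integrable_gaussian 0 p0.
apply: eq_integrable => // t _ /=.
by rewrite /gauss (expr2 (expR _)) -expRD; congr (expR _)%:E; ring.
Qed.

Let T_approx h : T h -> approx_by (fun t => (h t * gauss t)%:C).
Proof.
move=> Th; apply: approx_by_mem; apply: eqS (Th 0) => t.
rewrite /psi !mulr0 !mul0r addr0 cis0 mulr1.
by apply/esym; exact: rmorphM.
Qed.

(** Two values in [0, 1] differ by at most 1, so the squared Gaussian dominates the squared
    differences. *)
Let approx_by_bounded_cvg (h_ : nat -> R -> R) (h : R -> R) :
  (forall n, approx_by (fun t => (h_ n t * gauss t)%:C)) ->
  (forall n t, 0 <= h_ n t <= 1) -> (forall t, 0 <= h t <= 1) ->
  (forall t, h_ ^~ t @ \oo --> h t) -> approx_by (fun t => (h t * gauss t)%:C).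
Proof.
move=> ah h_1 h1 hh.
apply: (@approx_by_cvg (fun n t => h_ n t * gauss t) _ (fun t => gauss t ^+ 2)) => //.
- by move=> t; apply: cvgMl; exact: hh.
- exact: integrable_gauss_sqr.
- move=> n t; rewrite -mulrBl exprMn ler_piMl ?sqr_ge0//.
  have /andP[a1 a2] := h_1 n t; have /andP[b1 b2] := h1 t.
  rewrite -[_ ^+ 2]ger0_norm ?sqr_ge0// normrX exprn_ile1//.
  by rewrite ler_norml; apply/andP; split; lra.
Qed.

Let approx_sin_pos a x :
  approx_by (fun t => ((0 < sin (2 * pi * a * (t - x)))%R%:R * gauss t)%:C).
Proof.
apply: (@approx_by_bounded_cvg (fun m t => bd_poly m (q a x t))).
- by move=> m; apply: T_approx; exact: T_bd_poly.
- by move=> m t; apply: bd_poly_itv; exact: q_itv.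
- by move=> t; case: (_ < _); rewrite ?lexx ?ler01.
- move=> t; have /andP[q0 q1] := q_itv a x t.
  case: ltP => s0.
    by apply: cvg_bd_poly_lt; rewrite q0/= qE; lra.
  by apply: cvg_bd_poly_ge; rewrite q1 andbT qE; lra.
Qed.

(** The frequency [a n] is chosen so that the sine is sin ((t - x) / (n + 1)). Once |t - x| / (n +
    1) < pi, its sign is that of t - x. *)
Let approx_ray x : approx_by (fun t => (\1_(`]x, +oo[%classic) t * gauss t)%:C).
Proof.
pose a (n : nat) : R := (2 * pi * n.+1%:R)^-1.
have aE n y : 2 * pi * a n * y = y / n.+1%:R.
  by rewrite /a invfM mulrA divff ?mul1r 1?mulrC// mulf_neq0// gt_eqF// pi_gt0.
apply: (@approx_by_bounded_cvg (fun n t => (0 < sin (2 * pi * a n * (t - x)))%R%:R)).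
- by move=> n; exact: approx_sin_pos.
- by move=> n t; case: (_ < _); rewrite ?lexx ?ler01.
- by move=> t; rewrite indicE; case: (_ \in _); rewrite ?lexx ?ler01.
- move=> t; apply: cvg_near_cst; near=> n.
  rewrite aE indicE; congr (nat_of_bool _)%:R.
  have n0 : (0 : R) < n.+1%:R by [].
  have nt : `|t - x| / n.+1%:R < pi.
    rewrite ltr_pdivrMr// (@le_lt_trans _ _ n%:R)//; last first.
      rewrite (@lt_le_trans _ _ n.+1%:R) ?ltr_nat// ler_peMl//.
      by rewrite (le_trans _ (pi_ge2 R))// ler1n.
    by near: n; exact: nbhs_infty_ger.
  have [tx|tx] := ltP x t.
    rewrite mem_set/= ?in_itv/= ?tx//; apply: sin_gt0_pi.
    by rewrite divr_gt0 ?subr_gt0//= (le_lt_trans _ nt)// ler_pM2r ?invr_gt0// ler_norm.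
  rewrite memNset/= ?in_itv/= ?andbT; last by apply/negP; rewrite -leNgt.
  apply/negbTE; rewrite -leNgt -oppr_ge0 -sinN.
  apply: sin_ge0_pi; rewrite -mulNr opprB divr_ge0 ?subr_ge0//=.
  rewrite ltW// (le_lt_trans _ nt)// ler_pM2r ?invr_gt0// distrC ler_norm//.
Unshelve. all: by end_near.
Qed.

Let approx_sum (I : Type) (r : seq I) (f : I -> R -> R) :
  (forall i, approx_by (fun t => (f i t * gauss t)%:C)) ->
  approx_by (fun t => ((\sum_(i <- r) f i t) * gauss t)%:C).
Proof.
move=> af; elim: r => [|i r IH].
  have -> : (fun t => ((\sum_(i <- [::]) f i t) * gauss t)%:C) = (fun t => 0 * psi 0 0 t).
    by apply/funext => t; rewrite big_nil !mul0r.
  by apply: approx_byZ; exact: approx_by_mem.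
have -> : (fun t => ((\sum_(j <- i :: r) f j t) * gauss t)%:C) =
    (fun t => (f i t * gauss t)%:C + ((\sum_(j <- r) f j t) * gauss t)%:C).
  by apply/funext => t; rewrite big_cons mulrDl; exact: rmorphD.
exact: approx_byD.
Qed.

Let approx_scale (a : R) (f : R -> R) : approx_by (fun t => (f t * gauss t)%:C) ->
  approx_by (fun t => (a * f t * gauss t)%:C).
Proof.
move=> /(approx_byZ a%:C); set G1 := (G in approx_by G -> _); set G2 := (G in _ -> approx_by G).
suff -> : G1 = G2 by [].
by apply/funext => t; rewrite /G1 /G2 -mulrA; apply/esym; exact: rmorphM.
Qed.

(** Open right rays are stable under intersection and generate the Borel sets, so it suffices that
    the sets with approximable indicator form a Dynkin class. *)
Let approx_indic (A : set R) : measurable A ->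
  approx_by (fun t => (\1_A t * gauss t)%:C).
Proof.
move=> mA.
pose P (A : set R) := approx_by (fun t => (\1_A t * gauss t)%:C).
suff: forall A, <<s (@RGenOInfty.G R) >> A -> P A.
  apply; rewrite (esym (RGenOInfty.measurableE R) : <<s (@RGenOInfty.G R) >> = _).
  exact: mA.
apply: dynkin_induction; rewrite /P.
- exact: RGenOInfty.measurableE.
- move=> _ _ [x ->] [y ->]; exists (Num.max x y).
  by apply/seteqP; split => t /=; rewrite !in_itv/= !andbT gt_max => /andP.
- rewrite indicT; exact: (T_approx T1).
- by move=> _ [x ->]; exact: approx_ray.
- move=> B mB aB.
  have := approx_byD (T_approx T1) (approx_scale (-1) aB).
  set G1 := (G in approx_by G -> _); set G2 := (G in _ -> approx_by G).
  suff -> : G1 = G2 by [].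
  apply/funext => t; rewrite /G1 /G2 -[LHS]rmorphD /=; congr (_%:C).
  by rewrite !indicE in_setC; case: (t \in B) => /=; ring.
- move=> F mF tF aF.
  (* By disjointness at most one set [F k] contains t: the partial sums at t jump from 0 to 1 after
     index k, or vanish throughout. Hence they stay in [0, 1] and converge to the indicator of the
     union. *)
  have FE t : (exists k, (\bigcup_k F k) t /\
      forall n, \sum_(i <- index_iota 0 n) \1_(F i) t = (k < n)%N%:R :> R) \/
      (~ (\bigcup_k F k) t /\ forall n, \sum_(i <- index_iota 0 n) \1_(F i) t = 0 :> R).
    have [[k _ Fk]|nF] := pselect ((\bigcup_k F k) t); [left|right]; last first.
      split => // n; rewrite big1// => i _; rewrite indicE memNset// => Fi.
      by apply: nF; exists i.
    exists k; split; first by exists k.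
    have Fik i : \1_(F i) t = (i == k)%:R :> R.
      rewrite indicE; congr (nat_of_bool _)%:R.
      have [->|ik] := eqVneq i k; first by rewrite mem_set.
      rewrite memNset// => Fi; move/eqP : ik; apply.
      by apply: (tF i k I I); exists t.
    elim=> [|n IH]; first by rewrite big_geq.
    rewrite big_nat_recr//= IH Fik ltnS [(k <= n)%N]leq_eqVlt (eq_sym n k).
    by case: (ltngtP k n) => _; rewrite ?addr0 ?add0r.
  apply: (@approx_by_bounded_cvg (fun n t => \sum_(i <- index_iota 0 n) \1_(F i) t)).
  + by move=> n; apply: approx_sum.
  + move=> n t; have [[k [_ ->]]|[_ ->]] := FE t; last by rewrite lexx ler01.
    by case: (_ < _)%N; rewrite ?lexx ?ler01.
  + by move=> t; rewrite indicE; case: (_ \in _); rewrite ?lexx ?ler01.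
  + move=> t; have [[k [Ft FtE]]|[nFt FtE]] := FE t; apply: cvg_near_cst; near=> n.
      rewrite FtE indicE mem_set// (_ : (k < n)%N)//.
      by near: n; exact: nbhs_infty_gt.
    by rewrite FtE indicE memNset.
Unshelve. all: by end_near.
Qed.

Import HBNNSimple.

Let approx_nnsfun (f : {nnsfun R >-> R}) : approx_by (fun t => (f t * gauss t)%:C).
Proof.
under eq_fun do rewrite fimfunEord.
apply: approx_sum => i.
apply: approx_scale; exact: approx_indic.
Qed.

(** Simple functions increasing to u / [gauss], multiplied back by [gauss], lie between 0 and u, so
    [u ^+ 2] dominates the squared errors. *)
Let approx_nonneg (u : R -> R) : (forall t, 0 <= u t) ->
  measurable_fun [set: R] u ->
  mu.-integrable [set: R] (EFin \o (fun t => u t ^+ 2)) ->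
  approx_by (fun t => (u t)%:C).
Proof.
move=> u0 mu_ iu.
pose h t := u t / gauss t.
have g0 t : 0 < gauss t by exact: expR_gt0.
have mg : measurable_fun [set: R] (fun t => (gauss t)^-1).
  have -> : (fun t => (gauss t)^-1) = (fun t => expR (pi * t ^+ 2)).
    by apply/funext => t; rewrite /gauss -expRN opprK.
  apply: continuous_measurable_fun => t.
  apply: (continuous_comp (f := fun t : R => pi * t ^+ 2) (g := expR)); last exact: continuous_expR.
  by apply: cvgMr; apply: cvgM.
have mh : measurable_fun [set: R] (EFin \o h).
  by apply/measurable_EFinP; exact: measurable_funM.
pose phi := nnsfun_approx measurableT mh.
have h0 t : [set: R] t -> (0 <= (EFin \o h) t)%E.
  by move=> _; rewrite lee_fin divr_ge0// ltW.
have phi_h n t : phi n t <= h t.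
  by rewrite -lee_fin /phi nnsfun_approxE; exact: le_approx.
apply: (@approx_by_cvg (fun n t => phi n t * gauss t) u (fun t => u t ^+ 2)) => //.
- move=> t; rewrite [X in _ --> X](_ : u t = h t * gauss t); last by rewrite divfK// gt_eqF.
  apply: cvgMl.
  have := @cvg_nnsfun_approx _ _ _ _ measurableT _ mh h0 t I.
  by move/fine_cvg.
- move=> n t; rewrite ler_sqr ?nnegrE//.
    rewrite gerBl mulr_ge0//; last exact: ltW.
  rewrite subr_ge0 -ler_pdivlMr//; exact: phi_h.
Qed.

Lemma approx_by_L2 F : L2 R F -> approx_by F.
Proof.
move=> /L2P[[mRe mIm] iF].
(* A real square-integrable function is handled through its positive and negative parts; [v] will be
   the real, then the imaginary part of F. *)
have sq (v : R -> R) : measurable_fun [set: R] v -> (forall t, v t ^+ 2 <= csq (F t)) ->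
    approx_by (fun t => (v t)%:C).
  move=> mv vF.
  have i1 (w : R -> R) : measurable_fun [set: R] w -> (forall t, `|w t| <= `|v t|) ->
      mu.-integrable [set: R] (EFin \o (fun t => w t ^+ 2)).
    move=> mw wv; apply: le_integrable iF => //.
      by apply/measurable_EFinP; exact: measurable_funX.
    move=> t _ /=; rewrite lee_fin !ger0_norm ?sqr_ge0 ?csq_ge0// (le_trans _ (vF t))//.
    by rewrite -[leLHS]ger0_norm ?sqr_ge0// -[leRHS]ger0_norm ?sqr_ge0// !normrX ler_sqr ?nnegrE.
  have a1 : approx_by (fun t => (Num.max (v t) 0)%:C).
    apply: approx_nonneg => [t| |]; first by rewrite le_max lexx orbT.
      exact: measurable_maxr.
    apply: i1; first exact: measurable_maxr.
    by move=> t; case: (ltP (v t) 0) => // _; rewrite normr0.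
  have a2 : approx_by (fun t => (Num.max (- v t) 0)%:C).
    apply: approx_nonneg => [t| |]; first by rewrite le_max lexx orbT.
      by apply: measurable_maxr => //; exact: measurableT_comp.
    apply: i1; first by apply: measurable_maxr => //; exact: measurableT_comp.
    by move=> t; case: (ltP (- v t) 0) => // _; rewrite ?normr0 ?normrN.
  have := approx_byD a1 (approx_byZ (-1) a2).
  set G1 := (G in approx_by G -> _); set G2 := (G in _ -> approx_by G).
  suff -> : G1 = G2 by [].
  apply/funext => t; rewrite /G1 /G2 mulN1r -rmorphB; congr (_%:C).
  by case: (ltP (v t) 0) => ?; case: (ltP (- v t) 0) => ?; lra.
have aRe : approx_by (fun t => (complex.Re (F t))%:C).
  by apply: sq => // t; rewrite lerDl sqr_ge0.
have aIm : approx_by (fun t => (complex.Im (F t))%:C).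
  by apply: sq => // t; rewrite lerDr sqr_ge0.
have := approx_byD aRe (approx_byZ 'i aIm).
set G1 := (G in approx_by G -> _); suff -> : G1 = F by [].
by apply/funext => t; rewrite /G1 -complexE.
Qed.

End approximation.

(** * Counterexamples *)

Section counterexamples.
Context {R : realType}.
Let mu : {measure set (measurableTypeR R) -> \bar R} := @lebesgue_measure R.
Implicit Types (f g k : R -> R[i]).

Definition has_partner (p q r : R) k : Prop := L2 R k /\
  exists2 g, L2 R g & forall x w, gabor g x w = mult p q r x w * gabor k x w.

Lemma has_partnerD p q r k l : has_partner p q r k -> has_partner p q r l ->
  has_partner p q r (fun t => k t + l t).
Proof.
move=> [Lk [g Lg kg]] [Ll [h Lh lh]]; split; first exact: L2D.
exists (fun t => g t + h t); first exact: L2D.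
by move=> x w; rewrite !gaborD// kg lh mulrDr.
Qed.

Lemma has_partnerZ p q r z k : has_partner p q r k -> has_partner p q r (fun t => z * k t).
Proof.
move=> [Lk [g Lg kg]]; split; first exact: L2Z.
exists (fun t => z * g t); first exact: L2Z.
by move=> x w; rewrite !gaborZ// kg mulrCA.
Qed.

Lemma has_partner_psi p q r l : has_partner p q r (psi 0 l).
Proof.
split; first exact: L2_psi.
have [z zE] := gabor_psi_shift p q r l.
exists (fun t => z * psi (- q) (l + p) t); first by apply: L2Z; exact: L2_psi.
by move=> x w; rewrite gaborZ ?zE//; exact: L2_psi.
Qed.

(** With J the integral for F, c <= 1 gives c^2 J <= c J, and c (J + 1) <= e does the rest. Covering
    all small c allows several smallness conditions to be imposed together. *)
Lemma integral_csq_small (F : R -> R[i]) (e : R) : L2 R F -> 0 < e ->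
  exists2 d : R, 0 < d & forall c : R, 0 < c <= d ->
    (\int[mu]_t (csq (c%:C * F t))%:E < e%:E)%E.
Proof.
move=> /L2P[mF iF] e0.
have I0 : (0 <= \int[mu]_t (csq (F t))%:E)%E.
  by apply: integral_ge0 => t _; rewrite lee_fin csq_ge0.
have := integrable_fin_num measurableT iF.
have IE : (\int[mu]_t (EFin \o (fun t => csq (F t))) t = \int[mu]_t (csq (F t))%:E)%E by [].
rewrite IE; set J := (\int[mu]_t _)%E => /fineK Jfin.
have J0 : 0 <= fine J by exact: fine_ge0.
have J1 : 0 < fine J + 1 by rewrite ltr_wpDl.
exists (Num.min 1 (e / (fine J + 1))); first by rewrite lt_min ltr01 divr_gt0.
move=> c /andP[c0]; rewrite le_min => /andP[c1 ce].
rewrite integral_csqZ// csq_real -/J -Jfin -EFinM lte_fin.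
move: ce; rewrite ler_pdivlMr// => ce.
have : c ^+ 2 * fine J <= c * fine J by rewrite ler_wpM2r// expr2 ler_piMl// ltW.
by nra.
Qed.

(** A nonconstant affine function of c has at most one zero: half of it is a safe radius if it is
    positive, and any radius is safe otherwise. *)
Lemma affine_neq0_near0 (a b : R[i]) : b != 0 ->
  exists2 d : R, 0 < d & forall c : R, 0 < c <= d -> a + c%:C * b != 0.
Proof.
move=> b0; have [[d [d0 ad]]|nd] := pselect (exists d : R, 0 < d /\ a + d%:C * b = 0).
  exists (d / 2); first by rewrite divr_gt0.
  move=> c /andP[c0 cd]; apply/eqP => ac.
  have : (c%:C - d%:C) * b = 0.
    by rewrite mulrBl; apply/eqP; rewrite subr_eq0; apply/eqP; apply: (addrI a); rewrite ac ad.
  move/eqP; rewrite mulf_eq0 (negbTE b0) orbF subr_eq0 => /eqP [cdE].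
  by move: cd c0; rewrite cdE; lra.
exists 1 => // c /andP[c0 _]; apply/eqP => ac; apply: nd; by exists c.
Qed.

Lemma sin_pi_int (n : int) : sin (pi * n%:~R) = 0 :> R.
Proof.
have h (m : nat) : sin (pi * m%:R) = 0 :> R.
  elim: m => [|m IH]; first by rewrite mulr0 sin0.
  by rewrite -natr1 mulrDr mulr1 sinDpi IH oppr0.
case: n => m; first exact: h.
by rewrite NegzE mulrNz mulrN sinN -[_%:~R]/(m.+1%:R) h oppr0.
Qed.

Lemma mult_real (p q r x w : R) (n : int) : p * x + q * w + r = n%:~R ->
  exists a : R, mult p q r x w = a%:C.
Proof.
move=> E; exists (expR (pi * (p * w - q * x)) * cos (pi * n%:~R)).
by apply/eqP; rewrite /mult E /cis sin_pi_int eq_complex /= !mul0r mulr0 subr0 addr0 !eqxx.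
Qed.

(** The two numbers are complex conjugates. *)
Lemma norm_1iD (a : R) : `|1 + 'i * a%:C| = `|1 - 'i * a%:C|.
Proof.
rewrite !normc_def; congr ((Num.sqrt _)%:C) => /=; ring.
Qed.

Lemma integer_valued_form (Lambda : set 'cV[R]_2) :
  is_equidistant_parallel_lines Lambda \/ is_lattice Lambda ->
  exists p q r : R, p ^+ 2 + q ^+ 2 != 0 /\ forall z : 'cV[R]_2, Lambda z ->
    exists n : int, p * z 0 0 + q * z 1 0 + r = n%:~R.
Proof.
have sum2 (F : 'I_2 -> R) : \sum_i F i = F 0 + F 1.
  by rewrite !big_ord_recl big_ord0 addr0; congr (_ + F _); apply: val_inj.
case=> [[a [th [l0 [a0 ->]]]]|[k [k12 [L [/row_freeP[B LB] ->]]]]].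
  (* The form is the second coordinate of the vector z - lambda0 rotated back by th, divided by the
     spacing a. *)
  exists (- sin th / a), (cos th / a), (- (- sin th * l0 0 0 + cos th * l0 1 0) / a).
  split.
    rewrite !exprMn -mulrDl sqrrN addrC cos2Dsin2 mul1r.
    by rewrite expf_neq0// invr_neq0// gt_eqF.
  move=> _ [v /= [n vn] <-]; exists n.
  rewrite !mxE !sum2 !mxE /=.
  have h := cos2Dsin2 th.
  apply: (mulfI (lt0r_neq0 a0)); rewrite -vn.
  transitivity ((cos th ^+ 2 + sin th ^+ 2) * v 1 0); last by rewrite h mul1r.
  by field; rewrite gt_eqF.
have k0 : (0 < k)%N by case: k12 => ->.
pose i0 := Ordinal k0.
have BL : B^T *m L = 1%:M.
  by rewrite -[L]trmxK -trmx_mul LB trmx1.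
(* [B^T] is a left inverse of L, so its first row reads off the first integer coordinate of a
   lattice point, whether k is 1 or 2. *)
exists (B^T i0 0), (B^T i0 1), 0; split.
  apply/negP => /eqP h.
  have [h0 h1] : B^T i0 0 = 0 /\ B^T i0 1 = 0.
    by split; nra.
  have := congr1 (fun M : 'M[R]_k => M i0 i0) BL.
  rewrite !mxE sum2 h0 h1 !mul0r addr0 eqxx => /eqP.
  by rewrite eq_sym oner_eq0.
move=> _ [n _ <-]; exists (n i0 0).
have := congr1 (fun M : 'cV[R]_k => M i0 0) (mulmxA B^T L (map_mx (fun m : int => m%:~R : R) n)).
rewrite BL mul1mx [X in X = _]mxE sum2 addr0 => ->.
by rewrite mxE.
Qed.

Lemma counterexample_of_partner (Lambda : set 'cV[R]_2) (p q r d : R) k g :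
  p ^+ 2 + q ^+ 2 != 0 ->
  (forall z : 'cV[R]_2, Lambda z ->
    exists n : int, p * z 0 0 + q * z 1 0 + r = n%:~R) ->
  0 < d -> L2 R k -> L2 R g ->
  (forall x w, gabor g x w = mult p q r x w * gabor k x w) ->
  gabor k 0 0 != 0 -> gabor k (- q) p != 0 ->
  counterexamples Lambda (fun t => k t + d%:C * ('i * g t)).
Proof.
move=> pq0 hL d0 Lk Lg gE k0 k1.
have Lig : L2 R (fun t => 'i * g t) by exact: L2Z.
have Ldg (s : R[i]) : L2 R (fun t => s * ('i * g t)) by exact: L2Z.
have GE (s : R[i]) x w : gabor (fun t => k t + s * ('i * g t)) x w =
    (1 + 'i * s * mult p q r x w) * gabor k x w.
  by rewrite gaborD// gaborZ// gaborZ// gE mulrDl mul1r; congr (_ + _); ring.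
split; first exact: L2D.
exists (fun t => k t + (- d%:C) * ('i * g t)); split.
- exact: L2D.
- move=> [a ae].
  have ga x w : gabor (fun t => k t + d%:C * ('i * g t)) x w =
      cis a * gabor (fun t => k t + (- d%:C) * ('i * g t)) x w.
    rewrite -gaborZ; last exact: L2D.
    by apply: ae_eq_gabor => //; [exact: L2D|apply: L2Z; exact: L2D].
  have key x w : gabor k x w != 0 -> 1 + 'i * d%:C * mult p q r x w =
      cis a * (1 - 'i * d%:C * mult p q r x w).
    move=> nz; apply: (mulIf nz); rewrite -GE ga GE mulrA; congr (_ * _ * _).
    by rewrite mulrN mulNr.
  have m0 : mult p q r 0 0 = cis (pi * r).
    by rewrite /mult !mulr0 subrr mulr0 expR0 mul1r !add0r.
  (* From (0, 0) to (- q, p) the phase of [mult] is unchanged while its modulus grows by exp (pi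
     (p^2 + q^2)), which differs from 1. *)
  have m1 : mult p q r (- q) p = (expR (pi * (p ^+ 2 + q ^+ 2)))%:C * cis (pi * r).
    by rewrite /mult; congr ((expR _)%:C * cis _); ring.
  have := key _ _ k0; have := key _ _ k1; rewrite m0 m1.
  set E := (expR _)%:C; set u := 'i * d%:C * cis (pi * r) => e1 e0.
  have uE : 'i * d%:C * (E * cis (pi * r)) = E * u by rewrite /u; ring.
  rewrite uE in e1.
  (* Cross-multiplying the two equations eliminates [cis a]; all three factors of the remaining
     product are nonzero. *)
  have : 2 * (u * (1 - E)) = 0.
    have h : (1 + u) * (1 - E * u) = (1 + E * u) * (1 - u).
      by rewrite e0 e1; ring.
    have -> : 2 * (u * (1 - E)) = (1 + u) * (1 - E * u) - (1 + E * u) * (1 - u) by ring.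
    by rewrite h subrr.
  apply/eqP; rewrite !mulf_neq0//.
  + by rewrite eq_complex /= eqxx oner_eq0 andbF.
  + by rewrite eq_complex /= gt_eqF.
  + exact: cis_neq0.
  + rewrite subr_eq0 eq_sym eq_complex /= eqxx andbT.
    by rewrite -(expR0 R) (inj_eq (@expR_inj R)) mulf_neq0// gt_eqF// pi_gt0.
- move=> z Lz; rewrite !GE !normrM; congr (_ * _).
  have [n /mult_real[a ->]] := hL _ Lz.
  have := norm_1iD (d * a).
  have -> : (d * a)%:C = d%:C * a%:C :> R[i] by exact: rmorphM.
  by rewrite mulrN mulNr mulrA.
Qed.

End counterexamples.

(** * Density of the counterexamples *)

Theorem theorem4 (R : realType) (Lambda : set 'cV[R]_2)
    (hLambda : is_equidistant_parallel_lines Lambda \/ is_lattice Lambda) :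
  dense_in_L2 (counterexamples Lambda).
Proof.
have [p [q [r [pq0 hL]]]] := integer_valued_form hLambda.
split; first by move=> f [].
move=> f Lf e e0.
(* The squared error budget is e^2 = 2 (e^2 / 4) + 2 (e^2 / 4), one quarter for f - k. The other is
   split as 2 (e^2 / 16) + 2 (e^2 / 16) between the added Gaussian and the partner term. *)
have e16 : 0 < e ^+ 2 / 16 by rewrite divr_gt0// exprn_gt0.
have e4 : 0 < e ^+ 2 / 4 by rewrite divr_gt0// exprn_gt0.
have SL2 k : has_partner p q r k -> L2 R k by case.
have [mf fS] := approx_by_L2 SL2 (@has_partnerD R p q r) (@has_partnerZ R p q r)
  (has_partner_psi p q r) Lf.
have [k Sk fk] := fS _ e4.
have [d1 d1_gt0 psi_small] := integral_csq_small (L2_psi 0 0) e16.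
have [d2 d2_gt0 nz0] := affine_neq0_near0 (gabor k 0 0) (gabor_psi_neq0 0 0 0 0).
have [d3 d3_gt0 nz1] :=
  affine_neq0_near0 (gabor k (- q) p) (gabor_psi_neq0 0 0 (- q) p).
(* The added Gaussian must be small in L^2 and make the transform nonzero at both (0, 0) and (- q,
   p). *)
pose c := Num.min d1 (Num.min d2 d3).
have c_gt0 : 0 < c by rewrite !lt_min d1_gt0 d2_gt0.
have [cd1 cd2 cd3] : [/\ c <= d1, c <= d2 & c <= d3].
  by rewrite /c !ge_min !lexx !orbT.
have Lk := SL2 _ Sk.
have Lc : L2 R (fun t => c%:C * psi 0 0 t) by apply: L2Z; exact: L2_psi.
have [Lk1 [g Lg gE]] := has_partnerD Sk (has_partnerZ c%:C (has_partner_psi p q r 0)).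
have Lig : L2 R (fun t => 'i * g t) by exact: L2Z.
(* The partner g depends on c, so d is chosen after it. *)
have [d d_gt0 g_small] := integral_csq_small Lig e16.
have Ldg : L2 R (fun t => d%:C * ('i * g t)) by exact: L2Z.
have gk x w : gabor (fun t => k t + c%:C * psi 0 0 t) x w =
    gabor k x w + c%:C * gabor (psi 0 0) x w.
  by rewrite gaborD// gaborZ//; exact: L2_psi.
exists (fun t => k t + c%:C * psi 0 0 t + d%:C * ('i * g t)).
  by apply: (counterexample_of_partner pq0 hL d_gt0 Lk1 Lg gE); rewrite gk ?nz0 ?nz1 ?c_gt0.
apply: L2norm_lt => //.
have mk := (SL2 _ Sk).1.
have mfk : cmeasurable (fun t => f t + (-1) * k t).
  by apply: cmeasurableD => //; apply: cmeasurableM => //; exact: cmeasurable_cst.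
have L1 : L2 R (fun t => (-1) * (c%:C * psi 0 0 t + d%:C * ('i * g t))).
  by apply: L2Z; exact: L2D.
under eq_integral => t _.
  rewrite (_ : f t - _ = (f t + (-1) * k t) +
    ((-1) * (c%:C * psi 0 0 t + d%:C * ('i * g t)))); last by ring.
  over.
apply: le_lt_trans (integral_csqD_le mfk L1.1) _.
rewrite integral_csqZ; last exact: (L2D Lc Ldg).1.
have -> : csq (-1 : R[i]) = 1 by rewrite /csq /=; ring.
rewrite mul1e.
have -> : (e ^+ 2)%:E = (2%:E * (e ^+ 2 / 4)%:E + 2%:E * (e ^+ 2 / 4)%:E)%E.
  by rewrite -!EFinM -EFinD; congr (_%:E); field.
apply: lteD; rewrite lte_pmul2l//.
  by under eq_integral do rewrite mulN1r.
apply: le_lt_trans (integral_csqD_le Lc.1 Ldg.1) _.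
have -> : (e ^+ 2 / 4)%:E = (2%:E * (e ^+ 2 / 16)%:E + 2%:E * (e ^+ 2 / 16)%:E)%E.
  by rewrite -!EFinM -EFinD; congr (_%:E); field.
apply: lteD; rewrite lte_pmul2l//; first by apply: psi_small; rewrite c_gt0.
by apply: g_small; rewrite d_gt0 lexx.
Qed.
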